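(* Let $d\ge 3$. There exist positive constants $A$ and $\kappa$ (depending only on $d$) such that for every $r\ge 1$ and every $\rho>0$ satisfying $\rho\, r^{d-2}>A$, one has for every finite $\mathcal{C}\subset\mathbb{Z}^d$ $$\mathbb{P}\big(\ell_\infty(B_r(x))>\rho\, r^d\ \text{ for all } x\in\mathcal{C}\big)\le \exp\big(-\kappa\,\rho\,\mathrm{cap}(B_r(\mathcal{C}))\big).$$
   Context: $\|\cdot\|$ is the Euclidean norm. For $x\in\mathbb{Z}^d$ and $r\ge 1$ real, $B_r(x)=\{z\in\mathbb{Z}^d:\|z-x\|<r\}$, and for $\mathcal{C}\subset\mathbb{Z}^d$, $B_r(\mathcal{C})=\bigcup_{x\in\mathcal{C}}B_r(x)$. $(S_n)_{n\ge 0}$ is the simple random walk on $\mathbb{Z}^d$, $\mathbb{P}_x$ its law when started at $x$, and $\mathbb{P}=\mathbb{P}_0$. The local times are $\ell_\infty(z)=\sum_{k=0}^\infty \mathbf{1}\{S_k=z\}$ for $z\in\mathbb{Z}^d$, and $\ell_\infty(\Lambda)=\sum_{z\in\Lambda}\ell_\infty(z)$ for $\Lambda\subset\mathbb{Z}^d$. With $H^+_\Lambda=\inf\{n\ge 1:S_n\in\Lambda\}$, the capacity of a finite set $\Lambda\subset \mathbb{Z}^d$ is $\mathrm{cap}(\Lambda)=\sum_{x\in\Lambda}\mathbb{P}_x(H^+_\Lambda=\infty)$. *)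

(* Defs.v *)
From HB Require Import structures.
From mathcomp Require Import all_boot all_order all_algebra.
From mathcomp Require Import all_classical all_reals all_analysis.

Set Implicit Arguments.
Unset Strict Implicit.
Unset Printing Implicit Defensive.
Import Order.TTheory GRing.Theory Num.Theory.

Local Open Scope classical_set_scope.
Local Open Scope ring_scope.

(* The library norm on row vectors is the sup norm. *)
Definition euclid_norm (R : realType) (d : nat) (z : 'rV[int]_d) : R :=
  Num.sqrt (\sum_(i < d) ((z ord0 i)%:~R : R) ^+ 2).

Definition lball (R : realType) (d : nat) (r : R) (x : 'rV[int]_d) :
    set 'rV[int]_d :=
  [set z | euclid_norm R (z - x) < r].

Definition lball_set (R : realType) (d : nat) (r : R) (C : set 'rV[int]_d) :
    set 'rV[int]_d :=
  \bigcup_(x in C) lball r x.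

Definition srw_step (R : realType) (d : nat) (x y : 'rV[int]_d) : R :=
  if euclid_norm R (y - x) == 1 then (2 * d%:R)^-1 else 0.

(* [Px x] is the law under which the process [S] is the nearest-neighbour walk
   started at [x]; it is characterized by its finite-dimensional distributions.
   As the lattice is countable, measurability of [S n] is measurability of the
   events {S_n = z}. *)
Record simple_random_walk (R : realType) (d : nat) (disp : measure_display)
    (T : measurableType disp) (Px : 'rV[int]_d -> probability T R)
    (S : nat -> T -> 'rV[int]_d) : Prop := SimpleRandomWalk {
  srw_measurable : forall (n : nat) (z : 'rV[int]_d),
    measurable [set w | S n w = z];
  srw_law : forall (x : 'rV[int]_d) (n : nat) (p : nat -> 'rV[int]_d),
    Px x [set w | forall k : nat, (k <= n)%N -> S k w = p k] =
    ((p 0%N == x)%:R * \prod_(k < n) srw_step R (p k) (p k.+1))%:E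
}.

Definition local_time (R : realType) (d : nat) (T : Type)
    (S : nat -> T -> 'rV[int]_d) (z : 'rV[int]_d) (w : T) : \bar R :=
  (\sum_(0 <= k <oo) (\1_[set z] (S k w) : R)%:E)%E.

Definition local_time_set (R : realType) (d : nat) (T : Type)
    (S : nat -> T -> 'rV[int]_d) (L : set 'rV[int]_d) (w : T) : \bar R :=
  (\esum_(z in L) local_time R S z w)%E.

(* Takes the value +oo when [L] is never visited at a positive time, since
   [ereal_inf set0 = +oo]. *)
Definition return_time (R : realType) (d : nat) (T : Type)
    (S : nat -> T -> 'rV[int]_d) (L : set 'rV[int]_d) (w : T) : \bar R :=
  ereal_inf [set n%:R%:E | n in [set n : nat | (1 <= n)%N /\ L (S n w)]].

(* Only meaningful for finite [L]: a [\sum_(_ \in _)] with infinite support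
   is 0. *)
Definition capacity (R : realType) (d : nat) (disp : measure_display)
    (T : measurableType disp) (Px : 'rV[int]_d -> probability T R)
    (S : nat -> T -> 'rV[int]_d) (L : set 'rV[int]_d) : R :=
  \sum_(x \in L) fine (Px x [set w | return_time R S L w = +oo%E]).

(* Main.v *)
(** Let e be the equilibrium measure of B_r(C), so that its potential is at most
    1 and its mass is the capacity. Moving the mass e(y) of each point y of
    B_r(C) uniformly onto a ball of radius r that is centred in C and contains y
    multiplies the potential by at most a constant: the potential of the uniform
    measure on the ball is at most of order r^(2-d), while G(z,y) is at least of
    this order for z in the ball, and the comparison extends to all z by the
    maximum principle. Thus a small multiple phi of the new measure has potential
    at most 1/2, and then the sum of phi along the walk has an exponential moment
    at most 2. On the event of the theorem this sum is at least of order
    rho cap(B_r(C)). The prefactor 2 is absorbed by means of the same estimate for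
    a single ball, where rho r^(d-2) is large.

    The two bounds on the Green function avoid heat kernel asymptotics. The upper
    bound compares with the superharmonic function (|x|^2 + A)^(-1/2). The lower
    bound combines the reflection principle, by which the Green function decreases
    in the absolute value of each coordinate, with an explicit barrier showing
    that the walk spends a time of order r^2 in the points of a box of side of
    order r all of whose coordinates are at least r in absolute value. *)

Require Import Defs.
From HB Require Import structures.
From mathcomp Require Import all_boot all_order all_algebra.
From mathcomp Require Import all_classical all_reals all_analysis.
From mathcomp Require Import ring lra zify.

Set Implicit Arguments.
Unset Strict Implicit.
Unset Printing Implicit Defensive.
Import Order.TTheory GRing.Theory Num.Theory.

Local Open Scope classical_set_scope.
Local Open Scope ring_scope.

(** * Neighbour averages and truncated potentials of the lazy walk *)

Section Averages.
Variables (R : realType) (d : nat).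
Local Notation V := 'rV[int]_d.
Implicit Types (f g : V -> R) (x y z : V).

Definition unit_step (b : 'I_d * bool) : V :=
  if b.2 then - delta_mx ord0 b.1 else delta_mx ord0 b.1.

Definition avg f x : R :=
  (2 * d%:R)^-1 * \sum_(b : 'I_d * bool) f (x + unit_step b).

Lemma avg_pairE f x : avg f x = (2 * d%:R)^-1 *
  \sum_(i < d) (f (x + delta_mx ord0 i) + f (x - delta_mx ord0 i)).
Proof.
rewrite /avg; congr (_ * _).
rewrite -(pair_bigA _ (fun i b => f (x + unit_step (i, b)))) /=.
by apply: eq_bigr => i _; rewrite big_bool /= /unit_step /= addrC.
Qed.

Lemma unit_stepE (b : 'I_d * bool) i :
  unit_step b ord0 i = if i == b.1 then (if b.2 then -1 else 1) else 0.
Proof.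
rewrite /unit_step; case: b => j [] /=; rewrite !mxE eqxx /=;
by case: (i == j).
Qed.

Lemma avg_ge0 f x : (forall y, 0 <= f y) -> 0 <= avg f x.
Proof.
move=> f0; apply: mulr_ge0; last by apply: sumr_ge0.
by rewrite invr_ge0 mulr_ge0 ?ler0n.
Qed.

Lemma ler_avg f g x : (forall y, f y <= g y) -> avg f x <= avg g x.
Proof.
move=> fg; apply: ler_wpM2l; last by apply: ler_sum.
by rewrite invr_ge0 mulr_ge0 ?ler0n.
Qed.

Lemma eq_avg f g x : (forall y, f y = g y) -> avg f x = avg g x.
Proof. by move=> fg; rewrite (_ : f = g) //; apply/funext. Qed.

Lemma avgD f g x : avg (fun y => f y + g y) x = avg f x + avg g x.
Proof. by rewrite /avg big_split mulrDr. Qed.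

Lemma avgZ a f x : avg (fun y => a * f y) x = a * avg f x.
Proof. by rewrite /avg -mulr_sumr mulrCA. Qed.

Lemma avg_sum (I : Type) (s : seq I) (P : pred I) (F : I -> V -> R) x :
  avg (fun y => \sum_(i <- s | P i) F i y) x = \sum_(i <- s | P i) avg (F i) x.
Proof. by rewrite /avg exchange_big /= mulr_sumr. Qed.

Lemma avg_cst a x : (0 < d)%N -> avg (fun=> a) x = a.
Proof.
move=> d0; rewrite /avg sumr_const card_prod card_ord card_bool.
have d0' : d%:R != 0 :> R by rewrite pnatr_eq0 -lt0n.
by rewrite -[a *+ _]mulr_natr natrM; field.
Qed.

Lemma avg_shift f x a : avg (fun y => f (y + a)) x = avg f (x + a).
Proof. by rewrite /avg; congr (_ * _); apply: eq_bigr => b _; rewrite addrAC. Qed.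

Lemma avgN f x : avg (fun y => f (- y)) x = avg f (- x).
Proof.
rewrite !avg_pairE; congr (_ * _); apply: eq_bigr => i _.
by rewrite addrC opprB opprD addrC [_ - x]addrC addrC.
Qed.

(* Potential of the lazy walk up to time n. Laziness is harmless, as the limits
   in n coincide, and it makes reflection arguments insensitive to parity. *)
Fixpoint pot n f x : R :=
  if n is m.+1 then 2^-1 * (pot m f x + (f x + avg (pot m f) x)) else 0.

(** Comparison principle: the next truncation is at most the mean of [F] and [f + avg F], and both
    are at most [F]. *)
Lemma pot_le_excessive (F f : V -> R) n x : (forall y, 0 <= F y) ->
  (forall y, f y + avg F y <= F y) -> pot n f x <= F x.
Proof.
move=> F0 fF; elim: n x => [|n IH] x //=.
have := fF x; have := IH x; have := ler_avg x IH; lra.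
Qed.

Lemma pot_ge0 n f x : (forall y, 0 <= f y) -> 0 <= pot n f x.
Proof.
move=> f0; elim: n x => [|n IH] x //=.
by have := avg_ge0 x IH; have := IH x; have := f0 x; lra.
Qed.

Lemma pot_leS n f x : (forall y, 0 <= f y) -> pot n f x <= pot n.+1 f x.
Proof.
move=> f0; elim: n x => [|n IH] x; first exact: pot_ge0.
rewrite [leRHS]/= [leLHS]/=.
by have := IH x; have := ler_avg x IH; rewrite [pot n.+1 f x]/=; lra.
Qed.

Lemma pot_le n f g x : (forall y, f y <= g y) -> pot n f x <= pot n g x.
Proof.
move=> fg; elim: n x => [|n IH] x //=.
by have := IH x; have := ler_avg x IH; have := fg x; lra.
Qed.

Lemma potZ n a f x : pot n (fun y => a * f y) x = a * pot n f x.
Proof.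
elim: n x => [|n IH] x /=; first by rewrite mulr0.
by rewrite (eq_avg _ IH) avgZ IH; ring.
Qed.

Lemma pot_sum n (I : Type) (s : seq I) (F : I -> V -> R) x :
  pot n (fun y => \sum_(i <- s) F i y) x = \sum_(i <- s) pot n (F i) x.
Proof.
elim: n x => [|n IH] x /=; first by rewrite big1.
by rewrite (eq_avg _ IH) avg_sum IH -!big_split mulr_sumr.
Qed.

Lemma pot_shift n f x a : pot n (fun y => f (y + a)) x = pot n f (x + a).
Proof.
by elim: n x => [|n IH] x //=; rewrite (eq_avg _ IH) avg_shift IH.
Qed.

Lemma potN n f x : pot n (fun y => f (- y)) x = pot n f (- x).
Proof.
by elim: n x => [|n IH] x //=; rewrite (eq_avg _ IH) avgN IH.
Qed.

Lemma pot_homo n m f x : (forall y, 0 <= f y) -> (n <= m)%N ->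
  pot n f x <= pot m f x.
Proof.
move=> f0 /subnK <-; elim: (m - n)%N => [|k IH] //.
by rewrite addSn; apply: (le_trans IH); apply: pot_leS.
Qed.

(** Truncated Green function; the factor 1/2 in [pot] compensates for the doubled number of visits
    of the lazy walk. *)
Definition green n x y : R := pot n (fun z => (z == y)%:R) x.

Lemma green_ge0 n x y : 0 <= green n x y.
Proof. by apply: pot_ge0 => z; rewrite ler0n. Qed.

Lemma green_shift n x y : green n x y = green n (x - y) 0.
Proof.
by rewrite /green -pot_shift; congr pot; apply/funext => z; rewrite subr_eq0.
Qed.

Lemma greenN n x : green n (- x) 0 = green n x 0.
Proof.
by rewrite /green -potN; congr pot; apply/funext => z; rewrite oppr_eq0.
Qed.

End Averages.

(** * Upper bound on the potential of a ball *)

Section Barrier.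
Variable R : realType.

(** Taylor polynomial of order 3, with the next coefficient 35/128 enlarged to 1 so as to dominate
    the remainder. *)
Lemma inv_sqrt_taylor (u : R) : `|u| <= 2^-1 ->
  (Num.sqrt (1 + u))^-1 <= 1 - u / 2 + 3 / 8 * u ^+ 2 - 5 / 16 * u ^+ 3 + u ^+ 4.
Proof.
rewrite ler_norml => /andP[u1 u2].
set q := leRHS.
have q0 : 0 < q.
  have -> : q = 1 - u / 2 + u ^+ 2 * (3 / 8 - 5 / 16 * u + u ^+ 2).
    by rewrite /q; field.
  have := sqr_ge0 u => u20.
  have : 0 <= u ^+ 2 * (3 / 8 - 5 / 16 * u + u ^+ 2) by apply: mulr_ge0 => //; lra.
  lra.
have s0 : 0 < Num.sqrt (1 + u) by rewrite sqrtr_gt0; lra.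
rewrite -[leLHS]mul1r ler_pdivrMr// -[leLHS]sqrtr1 -[X in X * _](ger0_norm (ltW q0)).
rewrite -sqrtr_sqr -sqrtrM ?sqr_ge0// ler_wsqrtr//.
rewrite -subr_ge0.
(* Agreement with the Taylor series up to order 3 makes [u ^+ 4] factor out. *)
have -> : q ^+ 2 * (1 + u) - 1 = u ^+ 4 * (93 / 64 + 78 / 64 * u +
    u ^+ 2 * (- (99 / 256) + 57 / 256 * u + 3 / 8 * u ^+ 2 + u * u ^+ 2)).
  by rewrite /q; field.
apply: mulr_ge0; first by rewrite exprn_even_ge0.
have u2_ge0 : 0 <= u ^+ 2 by exact: sqr_ge0.
have u2_le : u ^+ 2 <= 4^-1.
  have -> : 4^-1 = 2^-1 ^+ 2 :> R by field.
  by rewrite -ler_sqrt ?exprn_gt0// !sqrtr_sqr [X in _ <= X]ger0_norm// ler_norml u1.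
have u3 : - 2^-1 * u ^+ 2 <= u * u ^+ 2 by rewrite ler_wpM2r.
set w := (X in u ^+ 2 * X).
have w1 : - 1 <= w by rewrite /w; lra.
have : u ^+ 2 * - 1 <= u ^+ 2 * w by rewrite ler_wpM2l.
clearbody w; lra.
Qed.

(** Here [N] stands for |x|^2 + A and [t] for a coordinate of x, a unit step changing |x|^2 by 1 +
    2t or 1 - 2t. In the expansions the odd powers of [t] cancel; [64 <= N] keeps the increments
    relative to [N] below 1/2, and 83 covers 3/4 from the quadratic terms and at most 82 from the
    quartic ones. *)
Lemma inv_sqrt_second_difference (N t : R) : 64 <= N -> t ^+ 2 <= N ->
  (Num.sqrt (N + (1 + 2 * t)))^-1 + (Num.sqrt (N + (1 - 2 * t)))^-1 <=
  (Num.sqrt N)^-1 * (2 - N^-1 + 3 * t ^+ 2 * N ^- 2 + 83 * N ^- 2).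
Proof.
move=> N64 tN; have N0 : 0 < N by lra.
have Nn0 : N != 0 by rewrite gt_eqF.
have small (v : R) : v ^+ 2 <= N -> `|(1 + 2 * v) / N| <= 2^-1.
  move=> vN; rewrite normrM normfV (gtr0_norm N0) ler_pdivrMr//.
  rewrite -(@ler_pXn2r _ 2) ?nnegrE ?mulr_ge0 ?normr_ge0 ?invr_ge0//; last lra.
  rewrite real_normK ?num_real//.
  have := sqr_ge0 (1 - 2 * v); have : 64 * N <= N * N by rewrite ler_wpM2r// ltW.
  rewrite exprMn !expr2 in vN *. lra.
have E (v : R) : v ^+ 2 <= N -> (Num.sqrt (N + (1 + 2 * v)))^-1 =
    (Num.sqrt N)^-1 * (Num.sqrt (1 + (1 + 2 * v) / N))^-1.
  move=> vN; rewrite -invfM -sqrtrM ?ltW//; congr (Num.sqrt _)^-1; by field.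
have Nt : (- t) ^+ 2 <= N by rewrite sqrrN.
have -> : 1 - 2 * t = 1 + 2 * - t by ring.
rewrite (E t tN) (E _ Nt) -mulrDr ler_wpM2l ?invr_ge0 ?sqrtr_ge0//.
apply: (le_trans (lerD (inv_sqrt_taylor (small _ tN)) (inv_sqrt_taylor (small _ Nt)))).
rewrite -subr_ge0.
have s0 : 0 < N^-1 by rewrite invr_gt0.
set a := t ^+ 2; have a0 : 0 <= a by exact: sqr_ge0.
set rhs := (X in 0 <= X).
have -> : rhs = N ^- 2 * (83 - 3 / 4 - (2 + 48 * a + 32 * a ^+ 2) / N ^+ 2
    + 5 / 16 * (2 + 24 * a) / N).
  by rewrite /rhs /a; field.
rewrite mulr_ge0 ?invr_ge0 ?exprn_ge0 ?ltW//.
have : (2 + 48 * a + 32 * a ^+ 2) / N ^+ 2 <= 82.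
  rewrite ler_pdivrMr ?exprn_gt0//; rewrite -/a in tN.
  have : a ^+ 2 <= N ^+ 2 by rewrite ler_pXn2r ?nnegrE// ltW.
  have : 64 * N <= N ^+ 2 by rewrite expr2 ler_wpM2r// ltW.
  lra.
have : 0 <= 5 / 16 * (2 + 24 * a) / N by rewrite divr_ge0 ?mulr_ge0//; lra.
lra.
Qed.

Variable d : nat.
Local Notation V := 'rV[int]_d.

Definition sqnorm (x : V) : R := \sum_(i < d) ((x ord0 i)%:~R) ^+ 2.

Lemma sqnorm_ge0 x : 0 <= sqnorm x.
Proof. by apply: sumr_ge0 => i _; apply: sqr_ge0. Qed.

Lemma sqnormD (x : V) i : sqnorm (x + delta_mx ord0 i) =
  sqnorm x + (1 + 2 * (x ord0 i)%:~R).
Proof.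
rewrite /sqnorm (bigD1 i)//= [in RHS](bigD1 i)//= !mxE !eqxx /= rmorphD/=.
rewrite (eq_bigr (fun j => ((x ord0 j)%:~R : R) ^+ 2)); first by ring.
by move=> j ji; rewrite !mxE (negPf ji) andbF addr0.
Qed.

Lemma sqnormB (x : V) i : sqnorm (x - delta_mx ord0 i) =
  sqnorm x + (1 - 2 * (x ord0 i)%:~R).
Proof.
rewrite /sqnorm (bigD1 i)//= [in RHS](bigD1 i)//= !mxE !eqxx /= rmorphB/=.
rewrite (eq_bigr (fun j => ((x ord0 j)%:~R : R) ^+ 2)); first by ring.
by move=> j ji; rewrite !mxE (negPf ji) andbF subr0.
Qed.

Lemma sqnorm_coord (x : V) i : ((x ord0 i)%:~R) ^+ 2 <= sqnorm x.
Proof.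
by rewrite /sqnorm (bigD1 i)//= lerDl; apply: sumr_ge0 => j _; apply: sqr_ge0.
Qed.

Hypothesis d3 : (3 <= d)%N.

Let f (A : R) (x : V) : R := (Num.sqrt (sqnorm x + A))^-1.

(** Over all coordinates the terms of order 1/N, with N = |x|^2 + A, sum to (3 - d)/N <= 0. What
    remains is (83 d - 3 A)/N^2 <= - 2 A/N^2, and the normalisation 1/(2d) gives the defect. *)
Let avg_f A x : 83 * d%:R <= A ->
  avg (f A) x <= f A x - A / d%:R * (sqnorm x + A) ^- 2 * f A x.
Proof.
move=> dA; have d0 : (3 : R) <= d%:R by rewrite ler_nat.
have x0 := sqnorm_ge0 x.
set N := sqnorm x + A; have N0 : 0 < N by rewrite /N; lra.
rewrite avg_pairE.
have s0 : 0 <= (Num.sqrt N)^-1 by rewrite invr_ge0 sqrtr_ge0.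
have : \sum_(i < d) (f A (x + delta_mx ord0 i) + f A (x - delta_mx ord0 i)) <=
    \sum_(i < d) ((Num.sqrt N)^-1 *
      (2 - N^-1 + 3 * ((x ord0 i)%:~R) ^+ 2 * N ^- 2 + 83 * N ^- 2)).
  apply: ler_sum => i _; rewrite /f sqnormD sqnormB !(addrAC _ _ A).
  apply: inv_sqrt_second_difference; first lra.
  by apply: (le_trans (sqnorm_coord x i)); rewrite lerDl; lra.
rewrite -mulr_sumr [X in _ * X](eq_bigr (fun i => (2 - N^-1 + 83 * N ^- 2) +
  3 * N ^- 2 * ((x ord0 i)%:~R) ^+ 2)); last first.
  by move=> i _; rewrite [LHS]addrAC [3 * _ * _]mulrAC.
rewrite [X in _ * X]big_split/= -mulr_sumr -/(sqnorm x) sumr_const card_ord -[_ *+ d]mulr_natr => le1.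
have e : sqnorm x = N - A by rewrite /N; ring.
have c0 : 0 <= (2 * d%:R : R)^-1 by rewrite invr_ge0; lra.
apply: (le_trans (ler_wpM2l c0 le1)).
rewrite -[f A x]/((Num.sqrt N)^-1) e; move: (Num.sqrt N)^-1 s0 => s s0.
have -> : s - A / d%:R / N ^+ 2 * s = s * (1 - A / d%:R / N ^+ 2).
  by rewrite mulrBr mulr1 [s * _]mulrC.
rewrite mulrCA; apply: ler_wpM2l => //.
rewrite -subr_ge0.
have -> : 1 - A / d%:R * N ^- 2 - (2 * d%:R)^-1 * ((2 - N^-1 + 83 * N ^- 2) * d%:R +
   3 * N ^- 2 * (N - A)) =
   (2 * d%:R)^-1 * ((d%:R - 3) * N + (A - 83 * d%:R)) * N ^- 2.
  by field; rewrite !gt_eqF//; lra.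
apply: mulr_ge0; last by rewrite invr_ge0 exprn_ge0// ltW.
apply: mulr_ge0 => //; have : 0 <= (d%:R - 3) * N by apply: mulr_ge0; lra.
lra.
Qed.

(* The function (|x|^2 + A)^(-1/2) with A of order r^2 is superharmonic because
   d >= 3, with a defect of order A^(-3/2) on the ball. *)
Lemma pot_ball_le n (r : R) (phi : V -> R) x0 z : 1 <= r ->
  (forall y, phi y <= (sqnorm (y - x0) <= r ^+ 2)%R%:R) ->
  pot n phi z <= 498 * d%:R ^+ 2 * r ^+ 2.
Proof.
move=> r1 phile; have d0 : (3 : R) <= d%:R by rewrite ler_nat.
have r2 : 1 <= r ^+ 2 by rewrite exprn_ege1.
pose A := 83 * d%:R * r ^+ 2.
have A83 : 83 * d%:R <= A by rewrite /A ler_peMr//; lra.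
have A0 : 0 < A by lra.
have A2 : 0 < Num.sqrt (2 * A) by rewrite sqrtr_gt0; lra.
(* [K] makes the defect of [F] equal to 1 where |y - x0|^2 + A = 2 A, the worst case on the ball
   since r^2 <= A. *)
pose K := 4 * d%:R * A * Num.sqrt (2 * A).
have K0 : 0 <= K by rewrite /K !mulr_ge0 ?sqrtr_ge0//; lra.
pose F y := K * f A (y - x0).
have f0 y : 0 <= f A y by rewrite invr_ge0 sqrtr_ge0.
have sA y : 0 < sqnorm y + A by have := sqnorm_ge0 y; lra.
have F_exc y : phi y + avg F y <= F y.
  have -> : avg F y = K * avg (f A) (y - x0).
    by rewrite -avg_shift -avgZ.
  have := ler_wpM2l K0 (avg_f (y - x0) A83); rewrite mulrBr => H.
  have : (sqnorm (y - x0) <= r ^+ 2)%R%:R <=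
      K * (A / d%:R * (sqnorm (y - x0) + A) ^- 2 * f A (y - x0)).
    have N0 := sA (y - x0).
    have p0 : 0 <= K * (A / d%:R * (sqnorm (y - x0) + A) ^- 2 * f A (y - x0)).
      apply: mulr_ge0 => //; apply: mulr_ge0 => //; apply: mulr_ge0.
        by apply: divr_ge0; lra.
      by rewrite invr_ge0 exprn_ge0// ltW.
    case: (boolP (sqnorm (y - x0) <= r ^+ 2)) => [yr|_]; last exact: p0.
    have N2A : sqnorm (y - x0) + A <= 2 * A.
      suff : r ^+ 2 <= A by lra.
      by rewrite /A ler_peMl//; lra.
    have -> : 1%:R = K * (A / d%:R * (2 * A) ^- 2 * (Num.sqrt (2 * A))^-1).
      by rewrite /K; field; rewrite !gt_eqF//; lra.
    apply: ler_wpM2l => //; apply: ler_pM.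
    - apply: mulr_ge0; first by apply: divr_ge0; lra.
      by rewrite invr_ge0 exprn_ge0//; lra.
    - by rewrite invr_ge0 sqrtr_ge0.
    - apply: ler_wpM2l; first by apply: divr_ge0; lra.
      rewrite lef_pV2 ?posrE ?exprn_gt0//; last lra.
      by rewrite ler_pXn2r// nnegrE; lra.
    - by rewrite lef_pV2 ?posrE//; [rewrite ler_wsqrtr|rewrite sqrtr_gt0].
  move=> H2; apply: (le_trans (lerD (phile y) H)).
  by rewrite addrCA gerDl subr_le0.
apply: le_trans (pot_le_excessive (F := F) n z _ F_exc) _.
  by move=> y; rewrite /F mulr_ge0.
have sA0 : 0 < Num.sqrt A by rewrite sqrtr_gt0.
have fle : f A (z - x0) <= (Num.sqrt A)^-1.
  rewrite lef_pV2 ?posrE//; last by rewrite sqrtr_gt0.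
  by rewrite ler_wsqrtr// lerDr sqnorm_ge0.
(* Rounding sqrt 2 up to 3/2 gives K / sqrt A <= 6 d A, hence 498 = 6 * 83. *)
have s2A : Num.sqrt (2 * A) <= 3 / 2 * Num.sqrt A.
  have -> : 3 / 2 = Num.sqrt ((3 / 2) ^+ 2) :> R by rewrite sqrtr_sqr ger0_norm.
  rewrite -sqrtrM ?sqr_ge0// ler_wsqrtr// ler_wpM2r// ltW//.
  by rewrite expr2; lra.
apply: (le_trans (ler_wpM2l K0 fle)).
rewrite ler_pdivrMr// /K; apply: (le_trans (ler_wpM2l _ s2A)).
  by rewrite !mulr_ge0//; lra.
rewrite [leLHS](_ : _ = 6 * d%:R * A * Num.sqrt A); last by field.
by rewrite ler_wpM2r ?sqrtr_ge0// /A [leRHS](_ : _ = 6 * d%:R * (83 * d%:R * r ^+ 2)) //; ring.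
Qed.

End Barrier.

(** * Monotonicity of the Green function by reflection *)

Section Reflection.
Variables (R : realType) (d : nat).
Local Notation V := 'rV[int]_d.

(** The mirror is where coordinate [i] equals k/2; an odd [k] puts it between lattice points. *)
Definition reflect_coord (i : 'I_d) (k : int) (x : V) : V :=
  x + (k - 2 * x ord0 i) *: delta_mx ord0 i.

Lemma avg_reflect (f : V -> R) i k x :
  avg f (reflect_coord i k x) = avg (f \o reflect_coord i k) x.
Proof.
rewrite /avg; congr (_ * _).
pose h (b : 'I_d * bool) := if b.1 == i then (b.1, ~~ b.2) else b.
have hK : involutive h.
  by move=> [j b]; rewrite /h /=; case: (eqVneq j i) => [->|/negPf ji] /=;
    rewrite ?eqxx ?ji ?negbK.
rewrite (reindex_inj (inv_inj hK)); apply: eq_bigr => -[j b] _ /=; congr f.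
apply/rowP => l; rewrite /reflect_coord /h /=.
case: (eqVneq j i) => [->|/negPf ji] /=; rewrite !mxE !unit_stepE /=;
  case: (eqVneq l i) => [->|/negPf li] /=;
  rewrite ?eqxx ?[i == j]eq_sym ?ji ?li; case: b; rewrite /=; ring.
Qed.

(* Reflection principle: the difference of the two sides is antisymmetric and
   nonnegative on the half space containing the origin; the lazy half step
   outweighs the only neighbour that may lie beyond the mirror. *)
Lemma green_reflect n i (k : int) (x : V) : 0 <= k -> 2 * x ord0 i <= k ->
  green R n (reflect_coord i k x) 0 <= green R n x 0.
Proof.
move=> k0; rewrite /green; set delta := (fun z : V => (z == 0)%:R : R).
have d0 : (1 : R) <= d%:R by rewrite ler1n (leq_ltn_trans _ (ltn_ord i)).
elim: n x => [|n IH] x xk //=.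
rewrite ler_pM2l ?invr_gt0//.
have [xk'|xk'] := eqVneq (2 * x ord0 i) k.
  by rewrite /reflect_coord xk' subrr scale0r addr0.
have {}xk : 2 * x ord0 i < k by rewrite lt_neqAle xk' xk.
set f := pot n delta.
pose D z := f z - f (reflect_coord i k z).
have D0 : 0 <= D x by rewrite subr_ge0; apply: IH; exact: ltW.
have deltaR : delta (reflect_coord i k x) = 0.
  rewrite /delta; case: eqP => // /(congr1 (fun z : V => z ord0 i)).
  by rewrite !mxE !eqxx /= => h; exfalso; lia.
have avgD_ge : - D x <= avg D x.
  have c0 : 0 < (2 * d%:R : R)^-1 by rewrite invr_gt0; lra.
  have c1 : (2 * d%:R : R)^-1 <= 1 by rewrite invf_le1; lra.
  have : \sum_(b : 'I_d * bool) - ((b == (i, false))%:R * D x) <=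
      \sum_(b : 'I_d * bool) D (x + unit_step b).
    apply: ler_sum => b _; case: (eqVneq b (i, false)) => [->|bi].
      rewrite mul1r /unit_step /=.
      have [h|h] := leP (2 * (x ord0 i + 1)) k.
        apply: (@le_trans _ _ 0); first by rewrite oppr_le0.
        by rewrite subr_ge0 IH// !mxE !eqxx.
      (* Since 2 x_i < k < 2 x_i + 2, here k = 2 x_i + 1: this neighbour is the mirror image of [x],
         and [D] equals [- D x] there. *)
      have e : reflect_coord i k x = x + delta_mx ord0 i.
        by rewrite /reflect_coord (_ : k - _ = 1) ?scale1r//; lia.
      rewrite /D e (_ : reflect_coord i k _ = x) ?opprB//.
      rewrite /reflect_coord !mxE !eqxx /= (_ : k - _ = -1); last by lia.
      by rewrite scaleN1r addrK.
    rewrite mul0r oppr0 subr_ge0 IH// !mxE unit_stepE.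
    case: b bi => j [] /=; case: (eqVneq i j) => [<-|ij]; rewrite ?eqxx//; lia.
  rewrite sumrN -mulr_suml (bigD1 (i, false))//= big1 ?addr0 ?eqxx; last first.
    by move=> b /negPf ->.
  rewrite mul1r => h; apply: le_trans (ler_wpM2l (ltW c0) h).
  by rewrite mulrN lerN2; apply: ler_piMl.
have delta0 : 0 <= delta x by rewrite /delta ler0n.
have avgDE : avg D x = avg f x - avg f (reflect_coord i k x).
  rewrite avg_reflect -mulN1r -avgZ -avgD; apply: eq_avg => y.
  by rewrite mulN1r.
by move: avgD_ge; rewrite avgDE deltaR /D; lra.
Qed.

(** Reflect with [k] equal to the sum of the old and the new coordinate; a negative [a] is reduced
    to a positive one by the symmetry x -> - x. *)
Lemma green_change_coord n i (a : int) (x : V) : `|x ord0 i| <= `|a| ->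
  green R n (x + (a - x ord0 i) *: delta_mx ord0 i) 0 <= green R n x 0.
Proof.
rewrite ler_norml => /andP[xa1 xa2]; have [a0|a0] := leP 0 a.
  rewrite ger0_norm// in xa1 xa2.
  rewrite (_ : a - _ = (a + x ord0 i) - 2 * x ord0 i); last by ring.
  by apply: green_reflect; lia.
rewrite ltr0_norm// in xa1 xa2; rewrite -greenN -[leRHS]greenN.
have -> : - (x + (a - x ord0 i) *: delta_mx ord0 i) =
    reflect_coord i (- a - x ord0 i) (- x).
  rewrite /reflect_coord opprD -scaleNr !mxE; congr (_ + _ *: _); ring.
by apply: green_reflect; rewrite ?mxE; lra.
Qed.

Lemma green_monotone n (x u : V) : (forall i, `|x ord0 i| <= `|u ord0 i|) ->
  green R n u 0 <= green R n x 0.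
Proof.
move=> xu; pose w (j : nat) : V := \row_i (if (i < j)%N then u ord0 i else x ord0 i).
have wd : w d = u by apply/rowP => i; rewrite !mxE ltn_ord.
have w0 : w 0%N = x by apply/rowP => i; rewrite !mxE ltn0.
suff : forall j, (j <= d)%N -> green R n (w j) 0 <= green R n x 0.
  by move=> /(_ d (leqnn _)); rewrite wd.
elim=> [|j IH] jd; first by rewrite w0.
apply: le_trans (IH (ltnW jd)).
have wj : w j ord0 (Ordinal jd) = x ord0 (Ordinal jd) by rewrite mxE /= ltnn.
have -> : w j.+1 = w j + (u ord0 (Ordinal jd) - w j ord0 (Ordinal jd)) *:
    delta_mx ord0 (Ordinal jd).
  apply/rowP => i; rewrite wj !mxE /= ltnS leq_eqVlt.
  case: (eqVneq i (Ordinal jd)) => [->|ij]; rewrite /= ?eqxx ?ltnn /=; first by ring.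
  rewrite mulr0 addr0; case: eqP => //= e.
  by case/eqP: ij; apply/val_inj.
by apply: green_change_coord; rewrite wj.
Qed.

End Reflection.

(** * Iterates of the lazy average and comparison from below *)

Section LazyIterates.
Variables (R : realType) (d : nat).
Local Notation V := 'rV[int]_d.
Implicit Types (f g : V -> R) (x y z : V).

Definition lazy_avg f x : R := 2^-1 * (f x + avg f x).

Lemma lazy_avg_sum (I : Type) (s : seq I) (F : I -> V -> R) x :
  lazy_avg (fun y => \sum_(i <- s) F i y) x = \sum_(i <- s) lazy_avg (F i) x.
Proof. by rewrite /lazy_avg avg_sum -big_split mulr_sumr. Qed.

Lemma lazy_avgZ a f x : lazy_avg (fun y => a * f y) x = a * lazy_avg f x.
Proof. by rewrite /lazy_avg avgZ; ring. Qed.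

Lemma lazy_avgD f g x : lazy_avg (fun y => f y + g y) x = lazy_avg f x + lazy_avg g x.
Proof. by rewrite /lazy_avg avgD; ring. Qed.

Lemma ler_lazy_avg f g x : (forall y, f y <= g y) -> lazy_avg f x <= lazy_avg g x.
Proof. by move=> fg; have := fg x; have := ler_avg x fg; rewrite /lazy_avg; lra. Qed.

Lemma pot_succ n f x : pot n.+1 f x = 2^-1 * f x + lazy_avg (pot n f) x.
Proof. by rewrite /= /lazy_avg; ring. Qed.

Lemma pot_iterE n f x : pot n f x = 2^-1 * \sum_(k < n) iter k lazy_avg f x.
Proof.
elim: n x => [|n IH] x; first by rewrite big_ord0 mulr0.
rewrite pot_succ big_ord_recl mulrDr; congr (_ + _).
rewrite (_ : pot n f = fun y => 2^-1 * \sum_(k < n) iter k lazy_avg f y); last first.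
  exact/funext.
by rewrite lazy_avgZ lazy_avg_sum.
Qed.

(** Counterpart of [pot_le_excessive] for lower bounds: the hypothesis gives w <= phi/2 + lazy_avg
    w, which is iterated. The last term is the mean of [w] at time [n], to be made small. *)
Lemma subharmonic_le_pot (w phi : V -> R) n x : (forall y, w y <= phi y + avg w y) ->
  w x <= pot n phi x + iter n lazy_avg w x.
Proof.
move=> h; elim: n x => [|n IH] x; first by rewrite add0r.
rewrite pot_succ iterS -addrA -lazy_avgD.
apply: (@le_trans _ _ (2^-1 * phi x + lazy_avg w x)).
  by have := h x; rewrite /lazy_avg; lra.
by rewrite lerD2l; apply: ler_lazy_avg.
Qed.

Lemma iter_lazy_avg_le a f g n x : (forall y, f y <= a * g y) ->
  iter n lazy_avg f x <= a * iter n lazy_avg g x.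
Proof.
move=> fg; elim: n x => [|n IH] x //=.
by rewrite -lazy_avgZ; apply: ler_lazy_avg.
Qed.

(** If all iterates exceeded [e], the potential up to [n] would be at least n e / 2, hence
    unbounded. This replaces a decay estimate for transition probabilities. *)
Lemma iter_lazy_avg_small f x (K e : R) : 0 < e -> (forall n, pot n f x <= K) ->
  exists n, iter n lazy_avg f x <= e.
Proof.
move=> e0 fK; apply: contrapT => /forallNP h.
have ge_e k : e <= iter k lazy_avg f x by apply/ltW; rewrite ltNge; apply/negP/h.
pose n := (Num.truncn (2 * `|K| / e)).+1.
have : 2^-1 * (n%:R * e) <= K.
  apply: le_trans (fK n); rewrite pot_iterE ler_wpM2l//.
  rewrite mulr_natl -[n in leLHS]card_ord -sumr_const.
  by apply: ler_sum => k _; exact: ge_e.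
have : 2 * `|K| / e < n%:R by exact: truncnS_gt.
rewrite ltr_pdivrMr// => lt1 le2.
have := ler_norm K; lra.
Qed.

End LazyIterates.

(** * Lower bound on the Green function by an explicit barrier *)

Section GreenLowerBound.
Variables (R : realType) (d : nat).
Local Notation V := 'rV[int]_d.
Hypothesis d3 : (3 <= d)%N.
Variable m : nat.
Hypothesis m_gt0 : (0 < m)%N.

Let dR3 : (3 : R) <= d%:R. Proof. by rewrite ler_nat. Qed.
Let mR1 : (1 : R) <= m%:R. Proof. by rewrite ler1n. Qed.

Let p (t : int) : int := Num.max 0 (`|t| - m%:Z).

Let p_second_difference t :
  p (t + 1) ^+ 2 + p (t - 1) ^+ 2 - 2 * p t ^+ 2 <= 2 * (m%:Z <= `|t|)%R%:R.
Proof.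
rewrite /p; have [mt|mt] := leP m%:Z `|t|; last first.
  rewrite !max_l ?expr0n//=; lia.
rewrite mulr1; have [t0|t0] := leP 0 t.
  have -> : Num.max 0 (`|t + 1| - m%:Z) = t + 1 - m%:Z by lia.
  have -> : Num.max 0 (`|t| - m%:Z) = t - m%:Z by lia.
  have : 0 <= Num.max 0 (`|t - 1| - m%:Z) <= `|t - 1 - m%:Z| by lia.
  move=> /andP[q0 q1].
  have : Num.max 0 (`|t - 1| - m%:Z) ^+ 2 <= (t - 1 - m%:Z) ^+ 2.
    by rewrite -[leRHS]real_normK ?num_real// ler_pXn2r// nnegrE normr_ge0.
  by move: (Num.max _ _) => q; rewrite !expr2; lia.
have -> : Num.max 0 (`|t - 1| - m%:Z) = 1 - t - m%:Z by lia.
have -> : Num.max 0 (`|t| - m%:Z) = - t - m%:Z by lia.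
have : 0 <= Num.max 0 (`|t + 1| - m%:Z) <= `|t + 1 + m%:Z| by lia.
move=> /andP[q0 q1].
have : Num.max 0 (`|t + 1| - m%:Z) ^+ 2 <= (t + 1 + m%:Z) ^+ 2.
  by rewrite -[leRHS]real_normK ?num_real// ler_pXn2r// nnegrE normr_ge0.
by move: (Num.max _ _) => q; rewrite !expr2; lia.
Qed.

(* The second difference of psi is 2d for |t| < m and at least -2 otherwise, so a
   single coordinate below m outweighs all the others. *)
Let psi (t : int) : R := d%:R * t%:~R ^+ 2 - (d.+1)%:R * (p t)%:~R ^+ 2.

Let psi_second_difference t :
  2 * d%:R - 2 * (d.+1)%:R * (m%:Z <= `|t|)%R%:R <= psi (t + 1) + psi (t - 1) - 2 * psi t.
Proof.
have := p_second_difference t; rewrite -[X in is_true X -> _](ler_int R).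
rewrite !(rmorphD, rmorphN, rmorphM, rmorphXn) /= /psi !(rmorphD, rmorphN) /=.
have -> : ((m%:Z <= `|t|)%R%:R)%:~R = (m%:Z <= `|t|)%R%:R :> R by case: leP.
set b : R := (_ <= _)%R%:R; rewrite -[(d.+1)%:R]natr1.
set A := (p (t + 1))%:~R; set B := (p (t - 1))%:~R; set C := (p t)%:~R.
move=> h; have : (d%:R + 1) * (A ^+ 2 + B ^+ 2 - 2 * C ^+ 2) <= (d%:R + 1) * (2 * b).
  by rewrite ler_wpM2l//; have := dR3; lra.
move: h => _ h; rewrite -subr_ge0 in h; rewrite -subr_ge0.
by apply: le_trans h _; rewrite le_eqVlt; apply/orP; left; apply/eqP; ring.
Qed.

(** With s = [p t] one has |t| <= m + s, and completing the square gives d (m + s)^2 - (d + 1) s^2 =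
    (d + d^2) m^2 - (s - d m)^2. *)
Let psi_bound t : psi t <= (d%:R + d%:R ^+ 2) * m%:R ^+ 2.
Proof.
have h : `|t|%:~R <= m%:R + (p t)%:~R :> R.
  rewrite -[m%:R]/((m%:Z)%:~R) -rmorphD ler_int /p; lia.
rewrite /psi -[t%:~R ^+ 2]real_normK ?num_real// -intr_norm.
have := dR3; have t0 : 0 <= `|t|%:~R :> R by rewrite ler0z.
set s := (p t)%:~R in h *; set a := `|t|%:~R in h t0 * => d3R.
have a2 : a ^+ 2 <= (m%:R + s) ^+ 2.
  by rewrite ler_pXn2r// nnegrE; lra.
have a2' : d%:R * a ^+ 2 <= d%:R * (m%:R + s) ^+ 2 by rewrite ler_wpM2l//; lra.
have := sqr_ge0 (s - d%:R * m%:R); rewrite -[(d.+1)%:R]natr1 => sq.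
rewrite -subr_ge0; rewrite -subr_ge0 in a2'.
by apply: le_trans (addr_ge0 a2' sq) _; rewrite le_eqVlt; apply/orP; left; apply/eqP; ring.
Qed.

Let M := ((4 * d ^ 2).+1 * m)%N.

(** The bound cancels the constant m^2 of [w] together with [d] times the maximum from [psi_bound].
    It comes from psi t = d m^2 - s (s - 2 d m), where s = |t| - m >= 4 d^2 m. *)
Let psi_far t : M%:Z < `|t| ->
  psi t <= - (1 + d%:R * (d%:R + d%:R ^+ 2)) * m%:R ^+ 2.
Proof.
move=> Mt.
have pt : p t = `|t| - m%:Z.
  by rewrite /p max_r// subr_ge0; apply: le_trans (ltW Mt); rewrite lez_nat /M; nia.
rewrite /psi pt -[t%:~R ^+ 2]real_normK ?num_real// -intr_norm rmorphB /=.
have : (M%:R : R) <= `|t|%:~R by rewrite -[M%:R]/((M%:Z)%:~R) ler_int ltW.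
rewrite /M natrM -natr1 natrM natrX -[(m%:Z)%:~R]/(m%:R) -[(d.+1)%:R]natr1.
have := dR3; have := mR1; set D := d%:R; set a := `|t|%:~R; set k := m%:R.
move=> k1 D3 aM.
pose s := a - k; have ks : 4 * D ^+ 2 * k <= s by rewrite /s; lra.
have -> : D * a ^+ 2 - (D + 1) * (a - k) ^+ 2 = D * k ^+ 2 - s * (s - 2 * D * k).
  by rewrite /s; ring.
have D2 : 3 * D <= D ^+ 2 by rewrite expr2 ler_wpM2r//; lra.
have DDk : 3 * D * k <= D ^+ 2 * k by rewrite ler_wpM2r//; lra.
have Dk0 : 0 <= D * k by apply: mulr_ge0; lra.
have : (4 * D ^+ 2 * k) * (2 * D ^+ 2 * k) <= s * (s - 2 * D * k).
  apply: ler_pM => //; [|by apply: mulr_ge0; [apply: mulr_ge0 => //; exact: sqr_ge0|lra]|].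
    by apply: mulr_ge0; [apply: mulr_ge0 => //; exact: sqr_ge0|lra].
  lra.
have D4 : D + D ^+ 2 + 1 + D ^+ 3 + D <= 8 * D ^+ 4.
  have D3' : 3 * D ^+ 2 <= D ^+ 3 by rewrite [leRHS]exprS ler_wpM2r// sqr_ge0.
  have : 3 * D ^+ 3 <= D ^+ 4.
    by rewrite [leRHS]exprS ler_wpM2r// exprn_ge0//; lra.
  lra.
have : (D + D ^+ 2 + 1 + D ^+ 3 + D) * k ^+ 2 <= 8 * D ^+ 4 * k ^+ 2.
  by rewrite ler_wpM2r// sqr_ge0.
set v := s * _; move=> H2 H1.
have -> : - (1 + D * (D + D ^+ 2)) * k ^+ 2 = - (1 + D ^+ 2 + D ^+ 3) * k ^+ 2 by ring.
have e1 : 4 * D ^+ 2 * k * (2 * D ^+ 2 * k) = 8 * D ^+ 4 * k ^+ 2 by ring.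
have : 0 <= D * k ^+ 2 by apply: mulr_ge0; [lra|exact: sqr_ge0].
rewrite e1 in H1; rewrite -subr_ge0 in H2; rewrite -subr_ge0 in H1.
move=> H3; rewrite -subr_ge0; apply: le_trans (addr_ge0 (addr_ge0 H2 H1) H3) _.
by rewrite le_eqVlt; apply/orP; left; apply/eqP; ring.
Qed.

Let w (x : V) : R := m%:R ^+ 2 + \sum_(i < d) psi (x ord0 i).

Let w_shift (x v : V) i a : v ord0 i = a -> (forall j, j != i -> v ord0 j = 0) ->
  w (x + v) = w x + (psi (x ord0 i + a) - psi (x ord0 i)).
Proof.
move=> va v0; rewrite /w (bigD1 i)//= [in RHS](bigD1 i)//= !mxE va.
rewrite (eq_bigr (fun j => psi (x ord0 j))); first by ring.
by move=> j ji; rewrite !mxE v0// addr0.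
Qed.

(** On the sector each coordinate contributes at least -2 to the total second difference, so
    division by 2d leaves a defect of at most 1; off it, the gain 2d of one small coordinate
    compensates for the others. *)
Let avg_w (x : V) : w x - avg w x <= [forall i, m%:Z <= `|x ord0 i|]%:R.
Proof.
have -> : avg w x = w x + (2 * d%:R)^-1 *
    \sum_(i < d) (psi (x ord0 i + 1) + psi (x ord0 i - 1) - 2 * psi (x ord0 i)).
  rewrite avg_pairE (eq_bigr (fun i => 2 * w x +
    (psi (x ord0 i + 1) + psi (x ord0 i - 1) - 2 * psi (x ord0 i)))); last first.
    move=> i _; rewrite (w_shift x (i := i) (a := 1)) ?(w_shift x (i := i) (a := -1)).
    - by ring.
    - by rewrite !mxE !eqxx.
    - by move=> j ji; rewrite !mxE (negPf ji) andbF oppr0.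
    - by rewrite !mxE !eqxx.
    - by move=> j ji; rewrite !mxE (negPf ji) andbF.
  rewrite big_split/= sumr_const card_ord -[_ *+ d]mulr_natr; field.
  by rewrite gt_eqF//; have := dR3; lra.
rewrite opprD addrA subrr add0r -mulrN; set S := \sum_(i < d) _.
have d0 : 0 < 2 * d%:R :> R by have := dR3; lra.
rewrite ler_pdivrMl//; case: (boolP [forall i, _]) => [_|].
  rewrite mulr1 lerNl; apply: (@le_trans _ _ (\sum_(i < d) (-2))).
    by rewrite sumr_const card_ord -[_ *+ d]mulr_natr; lra.
  apply: ler_sum => i _; apply: le_trans (psi_second_difference _).
  by rewrite -[d.+1%:R]natr1; case: (m%:Z <= _) => /=; have := dR3; lra.
rewrite negb_forall => /existsP[i0 /negPf xi0].
rewrite mulr0 oppr_le0 /S (bigD1 i0)//=.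
have := psi_second_difference (x ord0 i0); rewrite xi0 mulr0 subr0 => h0.
have h1 : \sum_(i < d | i != i0) (- 2 : R) <= \sum_(i < d | i != i0)
    (psi (x ord0 i + 1) + psi (x ord0 i - 1) - 2 * psi (x ord0 i)).
  apply: ler_sum => i _; apply: le_trans (psi_second_difference _).
  by rewrite -[d.+1%:R]natr1; case: (m%:Z <= _) => /=; have := dR3; lra.
have h2 : - (2 * d%:R) <= \sum_(i < d | i != i0) (- 2 : R).
  rewrite sumr_const -[leRHS]mulr_natr mulNr lerN2 ler_wpM2l// ler_nat.
  by apply: leq_trans (max_card _) _; rewrite card_ord.
lra.
Qed.

Let w_far (x : V) i : M%:Z < `|x ord0 i| -> w x <= 0.
Proof.
move=> xi; rewrite /w (bigD1 i)//=.
have h1 : \sum_(j < d | j != i) psi (x ord0 j) <=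
    (d%:R + d%:R ^+ 2) * m%:R ^+ 2 * d%:R.
  apply: (@le_trans _ _ (\sum_(j < d | j != i) (d%:R + d%:R ^+ 2) * m%:R ^+ 2)).
    by apply: ler_sum => j _; exact: psi_bound.
  rewrite sumr_const -[leLHS]mulr_natr ler_wpM2l//.
  by rewrite ler_nat; apply: leq_trans (max_card _) _; rewrite card_ord.
have h2 := psi_far xi.
have e : m%:R ^+ 2 + (- (1 + d%:R * (d%:R + d%:R ^+ 2)) * m%:R ^+ 2 +
  (d%:R + d%:R ^+ 2) * m%:R ^+ 2 * d%:R) = 0 :> R by ring.
by rewrite -[leRHS]e lerD2l; apply: lerD.
Qed.

Let W : R := 1 + (d%:R + d%:R ^+ 2) * d%:R.

Let w_le (x : V) : w x <= W * m%:R ^+ 2.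
Proof.
have -> : W * m%:R ^+ 2 = m%:R ^+ 2 + \sum_(i < d) (d%:R + d%:R ^+ 2) * m%:R ^+ 2.
  by rewrite sumr_const card_ord -[_ *+ d]mulr_natr /W; ring.
by rewrite lerD2l; apply: ler_sum => i _; exact: psi_bound.
Qed.


Let in_box (x : V) := [forall i, `|x ord0 i| <= M%:Z].
Let in_sector (x : V) := [forall i, m%:Z <= `|x ord0 i|].

(* The positive part of w is subharmonic off the sector and vanishes off the box,
   so the expected time spent in their intersection is at least w(0). *)
Let pot_sector_ge : exists n, 2^-1 * m%:R ^+ 2 <=
  pot n (fun x => (in_box x && in_sector x)%:R) 0 :> R.
Proof.
pose wp x : R := Num.max 0 (w x).
pose b x : R := (in_box x)%:R.
have wp_sub y : wp y <= (in_box y && in_sector y)%:R + avg wp y.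
  have avg0 : 0 <= avg wp y by apply: avg_ge0 => z; rewrite /wp le_max lexx.
  rewrite {1}/wp ge_max addr_ge0//=.
  have [wy|wy] := leP (w y) 0; first by apply: (le_trans wy); rewrite addr_ge0.
  have -> : in_box y.
    by apply/forallP => i; rewrite leNgt; apply/negP => /w_far; rewrite leNgt wy.
  rewrite -lerBlDr; apply: le_trans (avg_w y); rewrite lerD2l lerN2.
  by apply: ler_avg => z; rewrite /wp le_max lexx orbT.
have W0 : 0 < W.
  have := dR3; rewrite /W; set D := d%:R => D3.
  have : 0 <= (D + D ^+ 2) * D by rewrite mulr_ge0 ?addr_ge0 ?sqr_ge0; lra.
  lra.
have m2 : 0 < m%:R ^+ 2 :> R by rewrite exprn_gt0// ltr0n.
have wp_b y : wp y <= W * m%:R ^+ 2 * b y.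
  rewrite /wp /b ge_max mulr_ge0 ?mulr_ge0 ?(ltW W0) ?(ltW m2)//=.
  case: (boolP (in_box y)) => [_|]; first by rewrite mulr1; exact: w_le.
  by rewrite negb_forall => /existsP[i]; rewrite -ltNge mulr0; exact: w_far.
(* The box lies in a Euclidean ball of radius [d * M], so its potentials are bounded in [n]. *)
have bK n : pot n b 0 <= 498 * d%:R ^+ 2 * (d * M)%:R ^+ 2.
  apply: (@pot_ball_le R d d3 n (d * M)%:R b 0 0).
    by rewrite ler1n muln_gt0 (ltnW (ltnW d3)) /M muln_gt0.
  move=> y; rewrite /b subr0; case: (boolP (in_box y)) => // /forallP yb.
  suff -> : sqnorm R y <= (d * M)%:R ^+ 2 by [].
  apply: (@le_trans _ _ (\sum_(i < d) M%:R ^+ 2)).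
    apply: ler_sum => i _; rewrite -real_normK ?num_real// -intr_norm.
    rewrite ler_pXn2r ?nnegrE ?ler0z ?ler0n//.
    by rewrite -[M%:R]/((M%:Z)%:~R) ler_int.
  rewrite sumr_const card_ord -[_ *+ d]mulr_natr natrM exprMn mulrC.
  by rewrite ler_wpM2r ?exprn_ge0// expr2 ler_peMl//; have := dR3; lra.
(* At such a time the lazy walk is in the box with probability at most 1/(2W); as [wp] is at most W
   m^2, its mean is then at most half of [wp 0], which is m^2. *)
have [n nb] := iter_lazy_avg_small (ltac:(by rewrite invr_gt0 mulr_gt0) : 0 < (2 * W)^-1) bK.
exists n; have h1 := subharmonic_le_pot n 0 wp_sub.
have h2 := iter_lazy_avg_le n 0 wp_b.
have h3 : W * m%:R ^+ 2 * iter n (@lazy_avg R d) b 0 <= 2^-1 * m%:R ^+ 2.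
  have -> : 2^-1 * m%:R ^+ 2 = W * m%:R ^+ 2 * (2 * W)^-1 by field; rewrite gt_eqF.
  by apply: ler_wpM2l => //; apply: mulr_ge0; exact: ltW.
have w0 : wp 0 = m%:R ^+ 2.
  rewrite /wp /w big1 ?addr0 ?max_r ?(ltW m2)//.
  move=> i _; rewrite mxE /psi /p max_l ?normr0 ?sub0r ?oppr_le0//.
  by rewrite !rmorph0 expr0n /= !mulr0 subrr.
lra.
Qed.

(** The time spent in the sector within the box is shared by at most (2M + 1)^d points. Their
    coordinates are at least [m] in absolute value, those of [x] at most [m], so by [green_monotone]
    the Green function at [x] is the larger one. *)
Lemma green_lower : exists n, forall x : V, (forall i, `|x ord0 i| <= m%:Z) ->
  2^-1 * m%:R ^+ 2 <= (M.*2.+1 ^ d)%:R * green R n x 0.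
Proof.
have [n hn] := pot_sector_ge; exists n => x xm; apply: (le_trans hn).
pose u (f : {ffun 'I_d -> 'I_M.*2.+1}) : V := \row_i ((f i)%:Z - M%:Z).
pose s := enum [pred f | in_sector (u f)].
have le_sum y : (in_box y && in_sector y)%:R <= \sum_(f <- s) (y == u f)%:R :> R.
  case: (boolP (_ && _)) => [/andP[/forallP yb ys]|_]; last by apply: sumr_ge0.
  have yf i : (absz (y ord0 i + M%:Z)%R < M.*2.+1)%N by have := yb i; lia.
  pose f := [ffun i => Ordinal (yf i)] : {ffun 'I_d -> 'I_M.*2.+1}.
  have uf : y = u f.
    apply/rowP => i; rewrite mxE ffunE /= gez0_abs ?addrK//.
    by have := yb i; rewrite ler_norml -lerBlDr sub0r => /andP[].
  rewrite (bigD1_seq f) ?enum_uniq ?mem_enum ?inE -?uf//=.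
  by rewrite eqxx lerDl sumr_ge0.
apply: (le_trans (pot_le n 0 le_sum)); rewrite pot_sum.
apply: (@le_trans _ _ (\sum_(f <- s) green R n x 0)).
  rewrite big_seq [leRHS]big_seq; apply: ler_sum => f.
  rewrite mem_enum inE => /forallP us.
  rewrite -/(green R n 0 (u f)) green_shift sub0r greenN.
  by apply: green_monotone => i; apply: le_trans (xm i) (le_trans (us i) (ler_norm _)).
rewrite big_const_seq count_predT -Monoid.iteropE /= -[leLHS]mulr_natl.
rewrite ler_wpM2r ?green_ge0// ler_nat -cardE.
by apply: leq_trans (max_card _) _; rewrite card_ffun !card_ord.
Qed.

End GreenLowerBound.

(** * The potential of a ball against the Green function of one of its points *)

Section BallPotential.
Variables (R : realType) (d : nat).
Local Notation V := 'rV[int]_d.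
Hypothesis d3 : (3 <= d)%N.

Definition in_ball (r : R) (x y : V) : R := (euclid_norm R (y - x) < r)%R%:R.

Lemma in_ball_sqnorm r (x y : V) : euclid_norm R (y - x) < r -> sqnorm R (y - x) <= r ^+ 2.
Proof.
move=> yr; rewrite -[leLHS]sqr_sqrtr ?sqnorm_ge0//.
have r0 : 0 <= r by apply: le_trans (ltW yr); exact: sqrtr_ge0.
by rewrite ler_pXn2r ?nnegrE ?sqrtr_ge0// ltW.
Qed.

Lemma euclid_coord (r : R) (x : V) i : euclid_norm R x < r -> `|x ord0 i|%:~R < r.
Proof.
apply: le_lt_trans; rewrite intr_norm -sqrtr_sqr ler_wsqrtr//.
exact: sqnorm_coord.
Qed.

Lemma pot_in_ball_le : exists2 C : R, 0 < C & forall k (r : R) (x z : V), 1 <= r ->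
  pot k (in_ball r x) z <= C * r ^+ 2.
Proof.
exists (498 * d%:R ^+ 2).
  by apply: mulr_gt0; [lra|rewrite exprn_gt0// ltr0n (leq_trans _ d3)].
move=> k r x z r1; apply: (@pot_ball_le R d d3 k r (in_ball r x) x z r1) => y.
by rewrite /in_ball; case: ltP => // /in_ball_sqnorm ->.
Qed.

(** The bound 2r on the coordinates covers the difference of any two points of a ball of radius
    [r]. *)
Lemma green_lower_scale : exists2 c : R, 0 < c & forall r : R, 1 <= r ->
  exists n, forall x : V, (forall i, `|x ord0 i|%:~R <= 2 * r) ->
  r ^+ 2 <= c * r ^+ d * green R n x 0.
Proof.
(* Since m <= 3r and 2M + 1 <= 3M, the box has at most (b r)^d points. *)
pose b : R := 9 * (4 * d ^ 2).+1%:R.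
exists (b ^+ d); first by rewrite exprn_gt0// /b mulr_gt0// ltr0n.
move=> r r1; pose m := (Num.truncn (2 * r)).+1.
have m0 : (0 < m)%N by [].
have mr : m%:R <= 3 * r.
  rewrite /m -[leLHS]natr1; have : (Num.truncn (2 * r))%:R <= 2 * r by rewrite truncn_le; lra.
  lra.
have rm : 2 * r < m%:R by exact: truncnS_gt.
have [n hn] := green_lower R d3 m0; exists n => x xr.
have xm i : `|x ord0 i| <= m%:Z.
  by rewrite -(ler_int R); apply: le_trans (xr i) (ltW rm).
have := hn x xm; set M := (_ * m)%N => h.
apply: (@le_trans _ _ (2^-1 * m%:R ^+ 2)).
  have : (2 * r) ^+ 2 <= m%:R ^+ 2 by rewrite ler_pXn2r ?nnegrE ?ltW//; lra.
  rewrite exprMn; have := sqr_ge0 r; lra.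
apply: (le_trans h); rewrite ler_wpM2r ?green_ge0// natrX -exprMn.
have d0 : (0 < d)%N by exact: leq_trans d3.
have M1 : (1 : R) <= M%:R by rewrite ler1n muln_gt0.
rewrite ler_pXn2r ?nnegrE ?ler0n//; last by rewrite mulr_ge0 ?mulr_ge0//; lra.
rewrite -natr1 -muln2 natrM; apply: (@le_trans _ _ (3 * M%:R)); first lra.
rewrite /M /b natrM.
have := ler_wpM2l (ler0n R (4 * d ^ 2).+1) mr; lra.
Qed.

(** On the ball, the upper bound of order r^2 meets the lower bound of order r^(2-d) on the Green
    function. Elsewhere the source vanishes and the recursion propagates the inequality; the extra
    time [n] is what the lower bound consumes. *)
Lemma pot_ball_le_green : exists2 K : R, 0 < K & forall r : R, 1 <= r ->
  exists n, forall (k : nat) (x y z : V), euclid_norm R (y - x) < r ->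
  pot k (in_ball r x) z <= K * r ^+ d * green R (n + k) z y.
Proof.
have [c c0 hc] := green_lower_scale.
have [C1 C10 hC] := pot_in_ball_le.
exists (C1 * c); first exact: mulr_gt0.
move=> r r1; have [n hn] := hc r r1; exists n => k x y z yx.
have r0 : 0 <= r by lra.
have cr : 0 <= c * r ^+ d by apply: mulr_ge0; [exact: ltW|exact: exprn_ge0].
have Kr : 0 <= C1 * c * r ^+ d by rewrite -mulrA; apply: mulr_ge0 => //; exact: ltW.
have onball k' u : euclid_norm R (u - x) < r ->
    pot k' (in_ball r x) u <= C1 * c * r ^+ d * green R (n + k') u y.
  move=> ux; apply: (@le_trans _ _ (C1 * r ^+ 2)); first exact: hC.
  have /hn : forall i, `|(u - y) ord0 i|%:~R <= 2 * r.
    move=> i; have := euclid_coord i ux; have := euclid_coord i yx.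
    rewrite !intr_norm !mxE !rmorphB/= !ltr_norml ler_norml => /andP[? ?] /andP[? ?].
    by apply/andP; split; lra.
  rewrite -green_shift => h.
  rewrite -[_ * c * _]mulrA -mulrA; apply: ler_wpM2l; first exact: ltW.
  apply: (le_trans h); apply: ler_wpM2l; first exact: cr.
  by apply: pot_homo; [move=> v; rewrite ler0n|exact: leq_addr].
elim: k z => [|k IH] z.
  by apply: mulr_ge0 => //; exact: green_ge0.
have [/onball//|zx] := boolP (euclid_norm R (z - x) < r).
rewrite addnS /green /= -/(green R (n + k) z y) mulrCA ler_pM2l ?invr_gt0// mulrDr lerD//.
rewrite {1}/in_ball (negPf zx) add0r.
apply: (@le_trans _ _ (avg (fun u => C1 * c * r ^+ d * green R (n + k) u y) z)).
  exact: ler_avg.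
by rewrite avgZ ler_wpM2l// lerDr ler0n.
Qed.

End BallPotential.

(** * Avoidance probabilities and last exits *)

Section Survival.
Variables (R : realType) (d : nat).
Local Notation V := 'rV[int]_d.
Hypothesis d_gt0 : (0 < d)%N.
Variable L : pred V.

(** Probability that the simple walk from [x] misses [L] at times 0 to n; thus [avg (avoid n) x]
    concerns the times 1 to n + 1. *)
Fixpoint avoid n (x : V) : R :=
  (~~ L x)%:R * (if n is m.+1 then avg (avoid m) x else 1).

Lemma avoid_ge0 n x : 0 <= avoid n x.
Proof.
by elim: n x => [|n IH] x /=; rewrite mulr_ge0// avg_ge0.
Qed.

Lemma avoid_leS n x : avoid n.+1 x <= avoid n x.
Proof.
elim: n x => [|n IH] x.
  rewrite /= ler_wpM2l//; rewrite -[leRHS](avg_cst 1 x d_gt0).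
  by apply: ler_avg => y; rewrite mulr1 lern1 leq_b1.
by rewrite [leLHS]/= [leRHS]/= ler_wpM2l//; apply: ler_avg.
Qed.

(* Last-exit decomposition, truncated at time n. *)
Lemma pot_escape_le (e : V -> R) (s : seq V) n x : uniq s -> {subset s <= L} ->
  (forall k y, e y <= avg (avoid k) y) ->
  pot n (fun z => \sum_(y <- s) e y * (z == y)%:R) x <= 1 - avoid n x.
Proof.
move=> us sL he; set e' := (X in pot _ X).
have e'_le k z : e' z <= (L z)%:R * avg (avoid k) z.
  have [zs|zs] := boolP (z \in s).
    rewrite /e' (bigD1_seq z)//= eqxx mulr1 (sL z zs : L z) mul1r big1 ?addr0//.
    by move=> y /negPf yz; rewrite eq_sym yz mulr0.
  rewrite /e' big1_seq; first by apply: mulr_ge0 => //; apply: avg_ge0 => y; exact: avoid_ge0.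
  by move=> y /andP[_ ys]; case: eqP => [zy|]; rewrite ?mulr0//; rewrite zy ys in zs.
elim: n x => [|n IH] x.
  by rewrite /= mulr1 subr_ge0 lern1 leq_b1.
have := IH x; have := ler_avg x IH.
have -> : avg (fun y => 1 - avoid n y) x = 1 - avg (avoid n) x.
  rewrite -[X in X - _](avg_cst 1 x d_gt0) -mulN1r -avgZ -avgD.
  by apply: eq_avg => y; rewrite mulN1r.
(* On [L] the source is at most what the average of 1 - avoid n lacks to 1. Off [L] the source
   vanishes, and the monotonicity of [avoid] in time handles the lazy half. *)
have := avoid_leS n x; have := e'_le n x; rewrite [pot n.+1 _ x]/= [avoid n.+1 x]/=.
have := avoid_ge0 n x.
case: (L x) => /=; rewrite ?mul0r ?mul1r; lra.
Qed.

End Survival.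

(** * Exponential moments of additive functionals *)

Section ExponentialMoment.
Import numFieldNormedType.Exports.
Variables (R : realType) (d : nat).
Local Notation V := 'rV[int]_d.
Hypothesis d_gt0 : (0 < d)%N.

(** [H] is the increasing limit of the truncated potentials; their recursion becomes 2H = H + phi +
    avg H in the limit, so the laziness cancels. *)
Lemma excessive_majorant (phi : V -> R) (a : R) : (forall x, 0 <= phi x) ->
  (forall n x, pot n phi x <= a) -> exists H : V -> R,
  [/\ forall x, 0 <= H x, forall x, H x <= a & forall x, phi x + avg H x = H x].
Proof.
move=> phi0 phia.
have cv x : (fun n => pot n phi x) @ \oo --> limn (fun n => pot n phi x).
  apply: (@nondecreasing_is_cvgn R (fun n => pot n phi x)).
    by apply/nondecreasing_seqP => n; exact: pot_leS.
  by exists a => _ [n _ <-].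
exists (fun x => limn (fun n => pot n phi x)); split => x.
- by apply: limr_ge; [exact: cv|apply: nearW => n; exact: pot_ge0].
- by apply: limr_le; [exact: cv|apply: nearW => n; exact: phia].
set H : V -> R := fun x => _.
have cavg : avg (pot n phi) x @[n --> \oo] --> avg H x.
  rewrite /avg; apply: cvgMl_tmp; apply: cvg_big => [|b _]; [exact: add_continuous|exact: cv].
have c1 : pot n.+1 phi x @[n --> \oo] --> 2^-1 * (H x + (phi x + avg H x)).
  apply: cvgMl_tmp; apply: cvgD; first exact: cv.
  by apply: cvgD; [exact: cvg_cst|exact: cavg].
have c2 : pot n.+1 phi x @[n --> \oo] --> H x.
  by move: (cv x); rewrite -[X in X -> _]cvg_shiftS.
have e : 2^-1 * (H x + (phi x + avg H x)) = H x.
  exact: (cvg_unique _ c1 c2).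
by rewrite -[LHS]/(phi x + avg H x) -[RHS]/(H x); lra.
Qed.

(** Feynman-Kac recursion for the expectation of exp(phi(S_0) + ... + phi(S_n)). *)
Fixpoint exp_moment (phi : V -> R) n x : R :=
  expR (phi x) * (if n is m.+1 then avg (exp_moment phi m) x else 1).

(* With H the potential of phi, F = 1 + 2H satisfies e^phi avg F <= F, because
   F <= 2 and avg F = F - 2 phi. *)
Lemma exp_moment_le (phi : V -> R) n x : (forall y, 0 <= phi y) ->
  (forall k y, pot k phi y <= 2^-1) -> exp_moment phi n x <= 2.
Proof.
move=> phi0 /(excessive_majorant phi0)[H [H0 H1 HE]].
suff : exp_moment phi n x <= 1 + 2 * H x by have := H1 x; lra.
have step y (v : R) : 0 <= v -> v <= 1 + 2 * avg H y -> expR (phi y) * v <= 1 + 2 * H y.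
  move=> v0 hv; have avg0 : 0 <= avg H y by exact: avg_ge0.
  have := H1 y; have := HE y; have := phi0 y => p0 hE h1.
  (* Uses e^phi <= 1/(1 - phi), where phi <= H <= 1/2; then (1 - phi)(1 + 2H) exceeds 1 + 2 avg H =
     1 + 2H - 2 phi by phi (1 - 2H) >= 0. *)
  apply: (@le_trans _ _ ((1 - phi y)^-1 * (1 + 2 * avg H y))).
    apply: ler_pM; rewrite ?expR_ge0//.
    rewrite -[leLHS]invrK lef_pV2 ?posrE ?invr_gt0 ?expR_gt0//; last lra.
    by rewrite -expRN; have := expR_ge1Dx (- phi y); lra.
  rewrite ler_pdivrMl; last lra.
  have : 0 <= phi y * (1 - 2 * H y) by apply: mulr_ge0; lra.
  lra.
elim: n x => [|n IH] x; apply: step => //.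
- by have := avg_ge0 x H0; lra.
- apply: avg_ge0 => y; elim: (n) y => [|k IHk] y /=; rewrite mulr_ge0 ?expR_ge0//.
  exact: avg_ge0.
have -> : 1 + 2 * avg H x = avg (fun y => 1 + 2 * H y) x.
  by rewrite avgD avg_cst// avgZ.
exact: ler_avg.
Qed.

End ExponentialMoment.

(** * Expectations as averages over nearest-neighbour paths *)

Section Paths.
Variables (R : realType) (d : nat).
Local Notation V := 'rV[int]_d.
Hypothesis d_gt0 : (0 < d)%N.

Fixpoint paths n (x : V) : seq (seq V) :=
  if n is m.+1
  then [seq x :: p | b <- enum {: 'I_d * bool}, p <- paths m (x + unit_step b)]
  else [:: [:: x]].

Definition path_avg n (x : V) (f : seq V -> R) : R :=
  (2 * d%:R) ^- n * \sum_(p <- paths n x) f p.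

Lemma path_avg0 x f : path_avg 0 x f = f [:: x].
Proof. by rewrite /path_avg /= big_seq1 expr0 invr1 mul1r. Qed.

Lemma path_avgS n x f :
  path_avg n.+1 x f = avg (fun y => path_avg n y (fun p => f (x :: p))) x.
Proof.
rewrite /path_avg /= big_allpairs_dep big_enum /= /avg -mulr_sumr mulrA.
by rewrite exprS invfM.
Qed.

Lemma path_avgZ n x a f : path_avg n x (fun p => a * f p) = a * path_avg n x f.
Proof. by rewrite /path_avg -mulr_sumr mulrCA. Qed.

Lemma eq_path_avg n x f g : (forall p, f p = g p) -> path_avg n x f = path_avg n x g.
Proof. by move=> fg; rewrite (_ : f = g)//; exact/funext. Qed.

Lemma path_avg_le n x f g : (forall p, f p <= g p) -> path_avg n x f <= path_avg n x g.
Proof.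
move=> fg; apply: ler_wpM2l; first by rewrite invr_ge0 exprn_ge0// mulr_ge0 ?ler0n.
exact: ler_sum.
Qed.

Lemma path_avg_cst n x a : path_avg n x (fun=> a) = a.
Proof.
elim: n x => [|n IH] x; first by rewrite path_avg0.
by rewrite path_avgS (eq_avg _ IH) avg_cst.
Qed.

Lemma path_avg_exp (phi : V -> R) n x :
  path_avg n x (fun p => expR (\sum_(v <- p) phi v)) = exp_moment phi n x.
Proof.
elim: n x => [|n IH] x; first by rewrite path_avg0 big_seq1 /= mulr1.
rewrite path_avgS /= -avgZ; apply: eq_avg => y; rewrite -IH -path_avgZ.
by apply: eq_path_avg => p; rewrite big_cons expRD.
Qed.

Lemma path_avg_avoid (L : pred V) n x :
  path_avg n x (fun p => (all (predC L) p)%:R) = avoid R L n x.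
Proof.
elim: n x => [|n IH] x; first by rewrite path_avg0 /= andbT mulr1.
rewrite path_avgS /= -avgZ; apply: eq_avg => y; rewrite -IH -path_avgZ.
by apply: eq_path_avg => p /=; case: (L x); rewrite ?mul0r ?mul1r.
Qed.

Lemma paths_head n x p : p \in paths n x -> exists2 q, p = x :: q & size q = n.
Proof.
elim: n x p => [|n IH] x p /=; first by rewrite inE => /eqP ->; exists [::].
by move=> /allpairsPdep[b [q [_ /IH[q' -> sq] ->]]]; exists (x + unit_step b :: q') => //=; rewrite sq.
Qed.

Lemma unit_step_inj : injective (@unit_step d).
Proof.
move=> [i b] [j c] /rowP/(_ i); rewrite !unit_stepE /= eqxx.
by case: (eqVneq i j) => [->|_]; case: b; case: c.
Qed.

Lemma paths_uniq n x : uniq (paths n x).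
Proof.
elim: n x => [|n IH] x //=; apply: allpairs_uniq_dep; first exact: enum_uniq.
  by move=> b _; exact: IH.
move=> u v /allpairsPdep[b [p [_ /paths_head[p' -> _] ->]]].
move=> /allpairsPdep[c [q [_ /paths_head[q' -> _] ->]]] /= [/addrI/unit_step_inj -> ->].
by [].
Qed.

Lemma euclid_unit_step b : euclid_norm R (@unit_step d b) = 1.
Proof.
rewrite /euclid_norm (bigD1 b.1)//= big1.
  by rewrite addr0 unit_stepE eqxx; case: b.2; rewrite ?rmorphN ?sqrrN expr1n sqrtr1.
by move=> i /negPf ib; rewrite unit_stepE ib expr0n.
Qed.

Lemma paths_srw_step n x p : p \in paths n x ->
  \prod_(k < n) srw_step R (nth 0 p k) (nth 0 p k.+1) = (2 * d%:R) ^- n.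
Proof.
elim: n x p => [|n IH] x p /=; first by rewrite big_ord0 expr0 invr1.
move=> /allpairsPdep[b [q [_ qp ->]]]; rewrite big_ord_recl /= (IH _ _ qp).
have [q' -> _] := paths_head qp; rewrite /= /srw_step addrC addKr.
by rewrite euclid_unit_step eqxx [in RHS]exprS [RHS]invfM.
Qed.

Definition trajectory (T : Type) (S : nat -> T -> V) n (w : T) : seq V :=
  [seq S k w | k <- iota 0 n.+1].

End Paths.

(** * The law of finite trajectories *)

Section PathLaw.
Variables (R : realType) (d : nat).
Local Notation V := 'rV[int]_d.
Hypothesis d_gt0 : (0 < d)%N.
Variables (disp : measure_display) (T : measurableType disp).
Variables (Px : V -> probability T R) (S : nat -> T -> V).
Hypothesis srw : simple_random_walk Px S.

Lemma trajectory_eqE n (p : seq V) : size p = n.+1 ->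
  [set w | trajectory S n w = p] = [set w | forall k, (k <= n)%N -> S k w = nth 0 p k].
Proof.
move=> sp; apply/seteqP; split=> w /=.
  move=> <- k kn; rewrite /trajectory (nth_map 0%N) ?size_iota ?ltnS//.
  by rewrite nth_iota.
move=> h; apply: (@eq_from_nth _ 0); rewrite /trajectory size_map size_iota// => k kn.
by rewrite (nth_map 0%N) ?size_iota// nth_iota// h.
Qed.

Lemma measurable_trajectory_eq n (p : seq V) : measurable [set w | trajectory S n w = p].
Proof.
have [sp|sp] := eqVneq (size p) n.+1; last first.
  rewrite (_ : [set _ | _] = set0)//; apply/seteqP; split=> // w /= e.
  by move: sp; rewrite -e size_map size_iota eqxx.
rewrite trajectory_eqE//.
rewrite (_ : [set _ | _] = \bigcap_(k in [set k | (k <= n)%N]) [set w | S k w = nth 0 p k]).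
  by apply: bigcap_measurableType => k _; exact: (srw_measurable srw).
by apply/seteqP; split.
Qed.

(** There are only countably many finite sequences of lattice points. *)
Lemma measurable_trajectory n (Q : seq V -> Prop) : measurable [set w | Q (trajectory S n w)].
Proof.
rewrite (_ : [set _ | _] = \bigcup_(p : seq V) (if pselect (Q p) then [set w | trajectory S n w = p] else set0)).
  apply: countable_bigcupT_measurable; first exact: countableP.
  by move=> p; case: pselect => Qp; [exact: measurable_trajectory_eq|exact: measurable0].
apply/seteqP; split=> w /=.
  by move=> Qw; exists (trajectory S n w) => //; case: pselect.
by move=> [p _]; case: pselect => // Qp /= ->.
Qed.

Lemma trajectory_path_prob n x (p : seq V) : p \in paths n x ->
  Px x [set w | trajectory S n w = p] = ((2 * d%:R) ^- n)%:E.
Proof.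
move=> pp; have [q e sq] := paths_head pp.
have sp : size p = n.+1 by rewrite e /= sq.
by rewrite trajectory_eqE// (srw_law srw) (paths_srw_step _ pp) e /= eqxx mul1r.
Qed.

Lemma trajectory_in_prob n x (s : seq (seq V)) : uniq s -> {subset s <= paths n x} ->
  Px x [set w | trajectory S n w \in s] = ((2 * d%:R) ^- n *+ size s)%:E.
Proof.
move=> us sp.
rewrite (_ : [set _ | _] = \bigcup_(p in [set` s]) [set w | trajectory S n w = p]); last first.
  by apply/seteqP; split=> w /= => [ws|[p ps ->]//]; exists (trajectory S n w).
rewrite measure_fin_bigcup//; last first.
- by move=> p _; exact: measurable_trajectory_eq.
- by apply/trivIsetP => p q _ _ /eqP pq; apply/seteqP; split=> // w [/= wp wq]; case: pq; rewrite -wp -wq.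
  exact: finite_seq.
rewrite -fsbig_seq//= big_seq (eq_bigr (fun=> ((2 * d%:R) ^- n)%:E)); last first.
  by move=> p /sp; exact: trajectory_path_prob.
by rewrite -big_seq sumEFin big_const_seq count_predT -Monoid.iteropE.
Qed.

(** The (2d)^n paths from [x] have probability (2d)^(-n) each, so all other trajectories form a null
    set. *)
Lemma trajectory_prob_le n x (Q : pred (seq V)) :
  (Px x [set w | Q (trajectory S n w)] <= (path_avg n x (fun p => (Q p)%:R))%:E)%E.
Proof.
set B := [set w | _].
pose U (s : seq (seq V)) := [set w | trajectory S n w \in s].
have mU s : measurable (U s) by exact: (measurable_trajectory n (fun p => p \in s)).
have mB : measurable B by exact: (measurable_trajectory n Q).
have sizeE s : ((2 * d%:R) ^- n *+ size s : R) = (2 * d%:R) ^- n * \sum_(p <- s) 1.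
  by rewrite -[LHS]mulr_natr -sum1_size natr_sum.
have U1 : Px x (U (paths n x)) = 1%E.
  by rewrite trajectory_in_prob ?paths_uniq// sizeE -/(path_avg n x (fun=> 1)) path_avg_cst.
have -> : (path_avg n x (fun p => (Q p)%:R))%:E = Px x (U [seq p <- paths n x | Q p]).
  rewrite trajectory_in_prob ?filter_uniq ?paths_uniq//; last first.
    by move=> p; rewrite mem_filter => /andP[].
  rewrite sizeE big_filter big_mkcond/=; congr (_ * _)%:E.
  by apply: eq_bigr => p _; case: (Q p).
have -> : Px x (U [seq p <- paths n x | Q p]) =
    (Px x (U [seq p <- paths n x | Q p]) + Px x (~` U (paths n x)))%E.
  by rewrite probability_setC// U1 subee// adde0.
apply: le_trans (measureU2 _ _ _) => //; last exact: measurableC.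
apply: le_measure; rewrite ?inE//; first by apply: measurableU => //; exact: measurableC.
move=> w /= Bw; have [wp|wp] := boolP (trajectory S n w \in paths n x).
  by left; rewrite /U /= mem_filter wp andbT.
by right; exact/negP.
Qed.

End PathLaw.

(** * Local times and return times along trajectories *)

Section LocalTimes.
Variables (R : realType) (d : nat) (T : Type) (S : nat -> T -> 'rV[int]_d).
Local Notation V := 'rV[int]_d.

Lemma esum_indic1 (B : set V) (v : V) :
  \esum_(z in B) (\1_[set z] v : R)%:E = (\1_B v : R)%:E.
Proof.
rewrite (esumID [set v]); last by move=> z _; rewrite lee_fin.
rewrite [X in (_ + X)%E]esum1 ?adde0; last first.
  by move=> z [_ /= zv]; rewrite indicE memNset//= => /esym.
have [Bv|Bv] := pselect (B v).
  rewrite (_ : B `&` [set v] = [set v]).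
    by rewrite esum_set1 ?lee_fin// !indicE !mem_set.
  by apply/seteqP; split=> z [] // ->.
rewrite indicE memNset// (_ : B `&` [set v] = set0) ?esum_set0//.
by apply/seteqP; split=> z //= [Bz /= zv]; apply: Bv; rewrite -zv.
Qed.

(** Tonelli: the sums over points and over times are exchanged. *)
Lemma local_time_setE (B : set V) w :
  local_time_set R S B w = (\sum_(0 <= k <oo) (\1_B (S k w) : R)%:E)%E.
Proof.
have ind0 (D : set V) k : (0 <= (\1_D (S k w) : R)%:E)%E by rewrite lee_fin.
rewrite /local_time_set /local_time nneseries_esumT//.
transitivity (\esum_(z in B) \esum_(k in [set: nat]) (\1_[set z] (S k w) : R)%:E).
  by apply: eq_esum => z _; rewrite nneseries_esumT.
rewrite esum_esum//.
rewrite (reindex_esum ([set: nat] `*`` (fun=> B)) _ (fun x => (x.2, x.1))); last first.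
  split.
  - by move=> [k z] [/= _ Bz].
  - by move=> [k1 z1] [k2 z2] /= _ _ [-> ->].
  - by move=> [z k] [/= Bz _]; exists (k, z).
rewrite -(@esum_esum _ _ _ _ _ (fun k z => (\1_[set z] (S k w) : R)%:E))//.
by apply: eq_esum => k _; exact: esum_indic1.
Qed.

(** An increasing limit strictly exceeds [a] exactly when some partial sum does; this reduces the
    event to finite trajectories. *)
Lemma lt_local_time_set (a : R) (B : set V) w :
  (a%:E < local_time_set R S B w)%E <->
  exists n, a < \sum_(v <- trajectory S n w) \1_B v.
Proof.
have ind0 k : (0 <= (\1_B (S k w) : R)%:E)%E by rewrite lee_fin.
have trajE n : (\sum_(v <- trajectory S n w) \1_B v : R)%:E =
    (\sum_(0 <= k < n.+1) (\1_B (S k w) : R)%:E)%E.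
  by rewrite /trajectory big_map sumEFin /index_iota subn0.
rewrite local_time_setE; split.
  apply: contraPP => /forallNP h; apply/negP; rewrite -leNgt.
  apply: lime_le; first exact: is_cvg_nneseries.
  apply: nearW => -[|n]; last by rewrite -trajE lee_fin leNgt; apply/negP.
  (* The empty partial sum is treated apart, as a trajectory always contains time 0. *)
  rewrite big_geq// lee_fin; have /negP := h 0%N; rewrite -leNgt; apply: le_trans.
  by apply: sumr_ge0.
move=> [n an]; apply: (@lt_le_trans _ _ (\sum_(v <- trajectory S n w) \1_B v : R)%:E).
  by rewrite lte_fin.
by rewrite trajE; apply: nneseries_lim_ge.
Qed.

Lemma return_time_infinity (L : set V) w :
  return_time R S L w = +oo%E <-> forall n, (1 <= n)%N -> ~ L (S n w).
Proof.
split=> [h n n1 Ln|h]; last first.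
  rewrite /return_time (_ : [set _ | _ in _] = set0) ?ereal_inf0//.
  by apply/seteqP; split=> // t [n [n1 Ln] _]; exact: (h n n1 Ln).
have : (return_time R S L w <= n%:R%:E)%E by apply: ereal_inf_lbound; exists n.
by rewrite h leye_eq.
Qed.

End LocalTimes.

(** * Escape probabilities and exponential tails *)

Section Walk.
Variables (R : realType) (d : nat).
Local Notation V := 'rV[int]_d.
Hypothesis d_gt0 : (0 < d)%N.
Variables (disp : measure_display) (T : measurableType disp).
Variables (Px : V -> probability T R) (S : nat -> T -> V).
Hypothesis srw : simple_random_walk Px S.

Lemma measurable_escape (L : set V) : measurable [set w | return_time R S L w = +oo%E].
Proof.
rewrite (_ : [set _ | _] = \bigcap_(n in [set n | (1 <= n)%N]) ~` [set w | L (S n w)]).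
  apply: bigcap_measurableType => n _; apply: measurableC.
  rewrite (_ : [set _ | _] = [set w | L (nth 0 (trajectory S n w) n)]).
    exact: (measurable_trajectory srw n (fun p => L (nth 0 p n))).
  apply/seteqP; split=> w /=; rewrite (nth_map 0%N) ?size_iota//;
    by rewrite nth_iota.
apply/seteqP; split=> w.
  by move/(return_time_infinity R S L w).1 => h n; exact: h.
by move=> h; apply: (return_time_infinity R S L w).2 => n; exact: h.
Qed.

(** Escape implies avoidance at times 1 to n + 1. Time 0 is exempt from the return time, whence
    [behead] in the proof and the outer [avg] here. *)
Lemma escape_le (L : set V) n y :
  fine (Px y [set w | return_time R S L w = +oo%E]) <=
  avg (avoid R (fun v => `[< L v >]) n) y.
Proof.
set D := [set w | _]; set L' := fun v => _.
have mD : measurable D by exact: measurable_escape.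
rewrite -lee_fin fineK; last exact: fin_num_measure.
pose Q (p : seq V) := all (predC L') (behead p).
apply: (@le_trans _ _ (Px y [set w | Q (trajectory S n.+1 w)])).
  apply: le_measure; rewrite ?inE//.
    exact: (measurable_trajectory srw n.+1 Q).
  move=> w /return_time_infinity h; apply/allP => v.
  rewrite -[behead _]/[seq S k w | k <- iota 1 n.+1] => /mapP[k]; rewrite mem_iota => /andP[k1 _] ->.
  by apply/asboolP; exact: h.
apply: (le_trans (trajectory_prob_le d_gt0 srw _ _ _)).
rewrite lee_fin path_avgS.
by rewrite le_eqVlt; apply/orP; left; apply/eqP/eq_avg => z; rewrite -path_avg_avoid.
Qed.

(** Exponential Markov inequality at each finite time, then continuity from below: the events
    increase because [phi] is nonnegative. *)
Lemma exponential_tail (phi : V -> R) (t : R) x : (forall y, 0 <= phi y) ->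
  (forall k y, pot k phi y <= 2^-1) ->
  (Px x (\bigcup_n [set w | (t <= \sum_(v <- trajectory S n w) phi v)%R]) <=
    (2 * expR (- t))%:E)%E.
Proof.
move=> phi0 phi_half.
set F := fun n => [set w | t <= \sum_(v <- trajectory S n w) phi v].
have mF n : measurable (F n).
  exact: (measurable_trajectory srw n (fun p => t <= \sum_(v <- p) phi v)).
have ndF : nondecreasing_seq F.
  apply/nondecreasing_seqP => n; apply/subsetPset => w /= /le_trans; apply.
  rewrite /trajectory (_ : iota 0 n.+2 = iota 0 n.+1 ++ iota n.+1 1).
    rewrite map_cat big_cat lerDl.
    by rewrite sumr_ge0.
  by rewrite -iotaD addn1.
have cF := nondecreasing_cvg_mu (mu := Px x) mF (bigcupT_measurable F mF) ndF.
rewrite -(cvg_lim _ cF)//.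
apply: lime_le; first by apply/cvg_ex; eexists; exact: cF.
apply: nearW => n; apply: (le_trans (trajectory_prob_le d_gt0 srw n x
  (fun p => t <= \sum_(v <- p) phi v))).
rewrite lee_fin; apply: (@le_trans _ _
  (path_avg n x (fun p => expR (- t) * expR (\sum_(v <- p) phi v)))).
  apply: path_avg_le => p; case: (boolP (t <= _)) => [tp|_]; last first.
    by apply: mulr_ge0; exact: expR_ge0.
  rewrite -expRD -[leLHS]/(1 : R); apply: le_trans (expR_ge1Dx _); lra.
rewrite path_avgZ path_avg_exp mulrC ler_wpM2r ?expR_ge0//.
exact: exp_moment_le.
Qed.

End Walk.

(** * Large local times tested against weighted sums of balls *)

Section Folding.
Variables (R : realType) (d : nat).
Local Notation V := 'rV[int]_d.
Hypothesis d3 : (3 <= d)%N.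
Variables (disp : measure_display) (T : measurableType disp).
Variables (Px : V -> probability T R) (S : nat -> T -> V).
Hypothesis srw : simple_random_walk Px S.
Variables (r rho : R) (C : set V).

Let d_gt0 : (0 < d)%N. Proof. exact: leq_trans d3. Qed.

Let E := [set w | forall x, C x -> ((rho * r ^+ d)%R%:E < local_time_set R S (lball r x) w)%E].

Lemma indic_lball (x v : V) : \1_(lball r x) v = in_ball r x v :> R.
Proof.
rewrite indicE /in_ball; case: (boolP (_ < r)) => h; first by rewrite mem_set.
by rewrite memNset//; exact/negP.
Qed.

Let gt_trajectory (x : V) w : C x -> E w ->
  exists n, rho * r ^+ d < \sum_(v <- trajectory S n w) in_ball r x v.
Proof.
move=> Cx /(_ x Cx)/lt_local_time_set[n hn]; exists n.
by rewrite (eq_bigr _ (fun v _ => indic_lball x v)) in hn.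
Qed.

Lemma measurable_large_local_times : measurable E.
Proof.
rewrite (_ : E = \bigcap_(x in C) \bigcup_n [set w | rho * r ^+ d <
    \sum_(v <- trajectory S n w) (\1_(lball r x) v : R)]).
  rewrite -[X in measurable X]setCK setC_bigcap; apply: measurableC.
  rewrite bigcup_mkcond; apply: countable_bigcupT_measurable; first exact: countableP.
  move=> x; case: ifP => _; last exact: measurable0.
  apply: measurableC; apply: bigcupT_measurable => n.
  exact: (measurable_trajectory srw n
    (fun p => rho * r ^+ d < \sum_(v <- p) (\1_(lball r x) v : R))).
apply/seteqP; split=> w Ew x Cx.
  by have /lt_local_time_set[n hn] := Ew x Cx; exists n.
by have [n _ hn] := Ew x Cx; apply/lt_local_time_set; exists n.
Qed.

(** On [E] every ball has collected its visits by some finite time, and a common time serves the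
    finite list; exchanging sums bounds the sum of [phi] from below. Indexing by [s] lets several
    weights share a centre. *)
Lemma large_local_times_tail (I : eqType) (s : seq I) (a : I -> R) (c : I -> V) :
  (forall i, 0 <= a i) -> (forall i, i \in s -> C (c i)) ->
  (forall k z, pot k (fun v => \sum_(i <- s) a i * in_ball r (c i) v) z <= 2^-1) ->
  (Px 0%R E <= (2 * expR (- (rho * r ^+ d * \sum_(i <- s) a i)))%:E)%E.
Proof.
move=> a0 Cs half; set phi := (fun v => _) in half.
have phi0 v : 0 <= phi v.
  by apply: sumr_ge0 => i _; apply: mulr_ge0 => //; rewrite /in_ball ler0n.
apply: le_trans (exponential_tail d_gt0 srw (rho * r ^+ d * \sum_(i <- s) a i) 0 phi0 half).
apply: le_measure; rewrite ?inE.
- exact: measurable_large_local_times.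
- apply: bigcupT_measurable => n.
  exact: (measurable_trajectory srw n
    (fun p => rho * r ^+ d * \sum_(i <- s) a i <= \sum_(v <- p) phi v)).
move=> w Ew.
have mono i n m : (n <= m)%N -> \sum_(v <- trajectory S n w) in_ball r i v <=
    \sum_(v <- trajectory S m w) in_ball r i v.
  move=> nm; rewrite /trajectory (_ : iota 0 m.+1 = iota 0 n.+1 ++ iota n.+1 (m - n)).
    by rewrite map_cat big_cat lerDl sumr_ge0// => v _; rewrite /in_ball ler0n.
  by rewrite -iotaD addSn subnKC.
have [n hn] : exists n, forall i, i \in s ->
    rho * r ^+ d <= \sum_(v <- trajectory S n w) in_ball r (c i) v.
  elim: (s) Cs => [|i s' IH] Cs'; first by exists 0%N.
  have [n1 h1] := IH (fun j js => Cs' j (@mem_behead _ (i :: s') j js)).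
  have [n2 h2] := gt_trajectory (Cs' i (mem_head _ _)) Ew.
  exists (maxn n1 n2) => j; rewrite inE => /predU1P[->|js].
    by apply: le_trans (ltW h2) (mono _ _ _ _); exact: leq_maxr.
  by apply: le_trans (h1 j js) (mono _ _ _ _); exact: leq_maxl.
exists n => //=; rewrite /phi exchange_big/= mulr_sumr.
rewrite [leLHS]big_seq [leRHS]big_seq; apply: ler_sum => i si.
by rewrite -mulr_sumr mulrC ler_wpM2l// hn.
Qed.

Hypothesis r1 : 1 <= r.

(** The weight 1/(2 C1 r^2) on one ball brings its potential down to 1/2. *)
Lemma large_local_times_single (C1 : R) x : 0 < C1 -> C x ->
  (forall k z, pot k (in_ball r x) z <= C1 * r ^+ 2) ->
  (Px 0%R E <= (2 * expR (- (rho * r ^+ (d - 2) / (2 * C1))))%:E)%E.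
Proof.
move=> C10 Cx hC; have r0 : 0 < r by exact: lt_le_trans r1.
pose a (_ : unit) : R := (2 * C1 * r ^+ 2)^-1.
have a0 i : 0 <= a i.
  by rewrite /a invr_ge0; apply: mulr_ge0; [lra|exact: sqr_ge0].
have := @large_local_times_tail unit [:: tt] a (fun=> x) a0 (fun _ _ => Cx).
rewrite big_seq1 => h; apply: le_trans (h _) _ => [k z|]; last first.
  rewrite lee_fin ler_pM2l// ler_expR lerN2 /a -[in leRHS](subnK (ltnW d3)) exprD.
  rewrite le_eqVlt; apply/orP; left; apply/eqP; field.
  by rewrite !gt_eqF.
rewrite (_ : (fun v => _) = fun v => a tt * in_ball r x v); last first.
  by apply/funext => v; rewrite big_seq1.
rewrite potZ /a mulrC ler_pdivrMr; last by rewrite !mulr_gt0// exprn_gt0.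
by apply: le_trans (hC k z) _; lra.
Qed.

(* Each mass e(y) of the equilibrium measure is spread over the ball around the
   chosen centre c(y); no finiteness is needed, as the capacity is the junk value
   0 when e has infinite support. *)
Lemma large_local_times_capacity (K : R) n0 : 0 < K ->
  (forall k (x y z : V), euclid_norm R (y - x) < r ->
    pot k (in_ball r x) z <= K * r ^+ d * green R (n0 + k) z y) ->
  (Px 0%R E <= (2 * expR (- (rho * capacity Px S (lball_set r C) / (2 * K))))%:E)%E.
Proof.
move=> K0 hK; have r0 : 0 < r by exact: lt_le_trans r1.
have Kr : 0 < 2 * K * r ^+ d by rewrite !mulr_gt0// exprn_gt0.
set L := lball_set r C.
pose e y : R := fine (Px y [set w | return_time R S L w = +oo%E]).
have e0 y : 0 <= e y by exact: fine_ge0.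
have centre (y : V) : exists x, L y -> C x /\ euclid_norm R (y - x) < r.
  by have [[x Cx yx]|nL] := pselect (L y); [exists x|exists 0].
have [c hc] := choice centre.
rewrite /capacity -/e.
set s := finite_support 0 L _.
have XL y : y \in s -> L y.
  by rewrite /s; case: finite_supportP => // X XL _ _; exact: XL.
(* With this normalisation the potential is at most half the Green potential of [e], which last
   exits bound by 1. *)
pose a y := e y / (2 * K * r ^+ d).
have a0 y : 0 <= a y by rewrite divr_ge0// ltW.
have Cc y : y \in s -> C (c y) by move=> yX; exact: (hc y (XL y yX)).1.
have := @large_local_times_tail V (s) a c a0 Cc => h.
apply: le_trans (h _) _ => [k z|]; last first.
  rewrite lee_fin ler_pM2l// ler_expR lerN2 /a -mulr_suml.
  rewrite le_eqVlt; apply/orP; left; apply/eqP; field.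
  by rewrite !gt_eqF// exprn_gt0.
have sumE : pot k (fun v => \sum_(y <- s) a y * in_ball r (c y) v) z =
    \sum_(y <- s) a y * pot k (in_ball r (c y)) z.
  by rewrite pot_sum; apply: eq_bigr => y _; rewrite potZ.
rewrite sumE.
apply: (@le_trans _ _ (2^-1 * \sum_(y <- s) e y * green R (n0 + k) z y)).
  rewrite mulr_sumr [leLHS]big_seq [leRHS]big_seq; apply: ler_sum => y yX.
  apply: le_trans (ler_wpM2l (a0 y) (hK k (c y) y z (hc y (XL y yX)).2)) _.
  rewrite /a le_eqVlt; apply/orP; left; apply/eqP; field.
  by rewrite !gt_eqF// exprn_gt0.
rewrite -[leRHS]mulr1 ler_pM2l ?invr_gt0//.
have -> : \sum_(y <- s) e y * green R (n0 + k) z y =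
    pot (n0 + k) (fun u => \sum_(y <- s) e y * (u == y)%:R) z.
  by rewrite pot_sum; apply: eq_bigr => y _; rewrite potZ.
apply: le_trans (_ : 1 - avoid R (fun v => `[< L v >]) (n0 + k) z <= 1).
  apply: pot_escape_le => //; first exact: finite_support_uniq.
    by move=> y yX; apply/asboolP; exact: XL.
  by move=> n y; exact: escape_le.
by rewrite lerBlDr lerDl avoid_ge0.
Qed.

End Folding.

(** * Absorption of the prefactor 2 *)

Theorem theorem1p2 (R : realType) (d : nat) (hd : (3 <= d)%N) :
  exists A kappa : R, [/\ 0 < A, 0 < kappa &
    forall (disp : measure_display) (T : measurableType disp)
      (Px : 'rV[int]_d -> probability T R) (S : nat -> T -> 'rV[int]_d),
    simple_random_walk Px S ->
    forall r rho : R, 1 <= r -> 0 < rho -> A < rho * r ^+ (d - 2) ->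
    forall C : set 'rV[int]_d, finite_set C ->
    (Px 0%R [set w | forall x, C x ->
             (rho * r ^+ d)%R%:E < local_time_set R S (lball r x) w]
     <= (expR (- (kappa * rho * capacity Px S (lball_set r C))))%R%:E)%E].
Proof.
have [C1 C10 hC] := pot_in_ball_le R hd.
have [K K0 hK] := pot_ball_le_green R hd.
(* Half of the rate 1/(2K) is kept, so that the capacity bound reads 2 u^2; the factor 14 makes the
   single-ball exponent at least 7. *)
exists (14 * C1), (4 * K)^-1; split; [lra|by rewrite invr_gt0; lra|].
move=> disp T Px S srw r rho r1 rho0 hA C _.
(* For empty [C] the capacity is 0 and the right-hand side is 1. *)
have [->|/set0P[x Cx]] := eqVneq C set0.
  rewrite /capacity /lball_set bigcup_set0 fsbig_set0 mulr0 oppr0 expR0.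
  exact: (probability_le1 _ (measurable_large_local_times srw _ _ _)).
have [n0 hn0] := hK r r1.
have h1 := large_local_times_single hd srw rho r1 C10 Cx (fun k z => hC k r x z r1).
have h2 := @large_local_times_capacity R d hd disp T Px S srw r rho C r1 K n0 K0 hn0.
set cap := capacity Px S (lball_set r C) in h2 *.
set u := expR (- ((4 * K)^-1 * rho * cap)).
have u0 : 0 < u by exact: expR_gt0.
(* If u <= 1/2 then 2 u^2 <= u. Otherwise the single-ball bound is at most 2/(1 + 7), below 1/2 and
   hence below u. *)
have [u_half|u_half] := leP u 2^-1.
  apply: (le_trans h2); rewrite lee_fin.
  have -> : - (rho * cap / (2 * K)) = - ((4 * K)^-1 * rho * cap) + - ((4 * K)^-1 * rho * cap).
    by field; rewrite gt_eqF.
  rewrite expRD -/u; nra.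
apply: (le_trans h1); rewrite lee_fin; apply: (@le_trans _ _ 2^-1); last exact: ltW.
have t7 : 7 <= rho * r ^+ (d - 2) / (2 * C1) by rewrite ler_pdivlMr; lra.
rewrite expRN -[leRHS]mulr1 -[X in _ <= _ * X](mulfV (lt0r_neq0 (expR_gt0 (rho * r ^+ (d - 2) / (2 * C1))))).
rewrite mulrA ler_pM2r ?invr_gt0 ?expR_gt0//.
have := expR_ge1Dx (rho * r ^+ (d - 2) / (2 * C1)); lra.
Qed.
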